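(* Let $\mathfrak g$ be a simple Lie algebra, let $M$ be a lattice with $Q\subseteq M\subseteq\Lambda$, and put $m:=|M/Q|$ and $d:=\gcd(\ell,|M/Q|)$. Let $\eta\in\operatorname{Spec}(Z_0^M(\mathfrak g))$ be such that $\pi_M(\eta)=z\in Z(G_M)$. Then there exists a $1$-dimensional representation of $U_\eta^M(\mathfrak g)$ if and only if the order of $z$ divides $\frac md$.
   Context: Setting. $\mathfrak g$ is a complex simple Lie algebra of rank $n$ with root system $\Phi$, positive roots $\Phi^+$, simple roots $\Delta=\{\alpha_1,\dots,\alpha_n\}$, root lattice $Q$, weight lattice $\Lambda$, Weyl group $W$ with longest element $w_0$, and $W$-invariant form $(\cdot|\cdot)$ normalised by $(\alpha|\alpha)=2$ for short roots. $\ell>1$ is an odd integer, coprime to $3$ if $\mathfrak g$ is of type $G_2$; $\varepsilon\in\mathbb C$ is a primitive $\ell$-th root of $1$, and $\varepsilon_\alpha=\varepsilon^{(\alpha|\alpha)/2}$. Quantized enveloping algebra. For a lattice $Q\subseteq M\subseteq\Lambda$, $U_\varepsilon^M(\mathfrak g)$ is the $\mathbb C$-algebra with generators $E_\alpha,F_\alpha$ ($\alpha\in\Delta$), $K_\mu$ ($\mu\in M$) and relations $K_0=1$, $K_\mu K_\nu=K_{\mu+\nu}$, $K_\mu E_\alpha=\varepsilon^{(\mu|\alpha)}E_\alpha K_\mu$, $K_\mu F_\alpha=\varepsilon^{-(\mu|\alpha)}F_\alpha K_\mu$, $E_\alpha F_\beta-F_\beta E_\alpha=\delta_{\alpha,\beta}\frac{K_\alpha-K_{-\alpha}}{\varepsilon_\alpha-\varepsilon_\alpha^{-1}}$,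 and for $\alpha\ne\beta$ the quantum Serre relations $\sum_{a+b=1-2(\alpha|\beta)/(\alpha|\alpha)}(-1)^a\binom{a+b}{a}_{\varepsilon_\alpha}E_\alpha^aE_\beta E_\alpha^b=0$ and the same with $F$ in place of $E$, where $\binom{c}{d}_e$ is the Gaussian binomial (a Laurent polynomial in $e$) built from $[c]_e=\frac{e^c-e^{-c}}{e-e^{-1}}$. Fix a reduced decomposition of $w_0$; let $E_\gamma,F_\gamma$ ($\gamma\in\Phi^+$) be the corresponding Lusztig root vectors. The $\ell$-center $Z_0^M(\mathfrak g)$ is the central subalgebra generated by $E_\gamma^\ell,F_\gamma^\ell$ ($\gamma\in\Phi^+$) and $K_\mu^\ell$ ($\mu\in M$). $\operatorname{Spec}(Z_0^M(\mathfrak g))$ is identified with the set of algebra homomorphisms $\eta:Z_0^M(\mathfrak g)\to\mathbb C$. The reduced quantized enveloping algebra is $U_\eta^M(\mathfrak g)=U_\varepsilon^M(\mathfrak g)/(\ker\eta)U_\varepsilon^M(\mathfrak g)$. The group and the map $\pi_M$. $G_M$ is the connected complex semisimple algebraic group with Lie algebra $\mathfrak g$ and isogeny type $M$ (character lattice of its maximal torus $T_M$ equal to $M$), with center $Z(G_M)$; $B_M=T_M\ltimes U$ and $B_M^-=T_M\ltimes U^-$ are the Borel subgroup containing $T_M$ attached to $\Phi^+$ and its opposite. By De Concini–Kac–Procesi (''Quantum coadjoint action'') there is an identification $\operatorname{Spec}(Z_0^M(\mathfrak g))\simeq U^-\times T_M\times U\simeq\{(t^{-1}u,tv):t\in T_M,u\in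 U^-,v\in U\}$, an isomorphism of Poisson algebraic groups, where $u$ (resp. $v$) is the point whose (suitably normalised) coordinates, with respect to the description of $U^-$ (resp. $U$) as a product of root subgroups in the order given by the reduced decomposition of $w_0$, are given by the values $\eta(F_\gamma^\ell)$ (resp. $\eta(E_\gamma^\ell)$), and $\mu(t)=\eta(K_\mu^\ell)$ for $\mu\in M$. The map $\pi_M:\operatorname{Spec}(Z_0^M(\mathfrak g))\to B_M^-B_M\subseteq G_M$ is $(x,y)\mapsto x^{-1}y$, i.e. $\pi_M(\eta)=u^{-1}t^2v$. *)

(* Defs.v *)
From HB Require Import structures.
From mathcomp Require Import all_boot all_order all_algebra.
From mathcomp Require Import boolp classical_sets functions cardinality reals.
From mathcomp Require Import complex monalg ring.

Set Implicit Arguments.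
Unset Strict Implicit.
Unset Printing Implicit Defensive.

Import GRing.Theory Num.Theory.
Local Open Scope ring_scope.
Local Open Scope quotient_scope.

(* An associative unital R-algebra is a ring with a ring morphism from R to   *)
(* its center. Unlike [algType], the zero ring is allowed, since a quotient   *)
(* algebra is not known a priori to be nonzero.                               *)
HB.mixin Record hasScalars (R : comNzRingType) A of GRing.PzRing A := {
  scal : R -> A;
  scal_zmod : zmod_morphism scal;
  scal_monoid : monoid_morphism scal;
  scal_central : forall (c : R) (x : A), scal c * x = x * scal c
}.

#[short(type="assocAlgType")]
HB.structure Definition AssocAlgebra (R : comNzRingType) :=
  {A of GRing.PzRing A & hasScalars R A}.

HB.instance Definition _ (R : comNzRingType) (A : assocAlgType R) :=
  GRing.isZmodMorphism.Build R A (@scal R A) scal_zmod.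
HB.instance Definition _ (R : comNzRingType) (A : assocAlgType R) :=
  GRing.isMonoidMorphism.Build R A (@scal R A) scal_monoid.

Fact id_zmod_morphism (V : zmodType) : zmod_morphism (@idfun V).
Proof. by []. Qed.

Fact id_monoid_morphism (R : pzRingType) : monoid_morphism (@idfun R).
Proof. by split. Qed.

HB.instance Definition _ (R : comNzRingType) :=
  hasScalars.Build R R^o (@id_zmod_morphism R) (@id_monoid_morphism R)
    (@mulrC R).

Section MatrixAlgebra.
Variables (R : comNzRingType) (n : nat).

Fact scalar_mx_zmod : zmod_morphism (@scalar_mx R n).
Proof. exact: raddfB. Qed.

Fact scalar_mx_monoid : monoid_morphism (@scalar_mx R n).
Proof. by split=> // a b; rewrite scalar_mxM. Qed.

Fact scalar_mx_central (c : R) (x : 'M[R]_n) : c%:M * x = x * c%:M.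
Proof. exact: comm_scalar_mx. Qed.

HB.instance Definition _ := hasScalars.Build R 'M[R]_n
  scalar_mx_zmod scalar_mx_monoid scalar_mx_central.
End MatrixAlgebra.

Section FreeAlgebra.
Variables (R : comNzRingType) (I : choiceType).

Fact malgC_zmod : zmod_morphism (@malgC {fmonom I} R).
Proof. exact: raddfB. Qed.

Fact malgC_monoid : monoid_morphism (@malgC {fmonom I} R).
Proof. by split=> [|a b]; rewrite ?rmorph1 ?rmorphM. Qed.

Fact malgC_central (c : R) (x : {malg R[{fmonom I}]}) :
  c%:MP * x = x * c%:MP.
Proof.
rewrite [LHS]fgmulUg [RHS]fgmulgU; apply: eq_bigr => k _.
by rewrite mul1m mulm1 mulrC.
Qed.

HB.instance Definition _ := hasScalars.Build R {malg R[{fmonom I}]}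
  malgC_zmod malgC_monoid malgC_central.

Definition free_gen (i : I) : {malg R[{fmonom I}]} := << fmu i >>.

(* The endomorphism of the free algebra extending a map on generators.        *)
Definition free_lift (h : I -> {malg R[{fmonom I}]}) :
    {malg R[{fmonom I}]} -> {malg R[{fmonom I}]} :=
  mmap (@malgC {fmonom I} R) (fun s : {fmonom I} => \prod_(i <- s) h i).

Fact free_lift_gen h i : free_lift h (free_gen i) = h i.
Proof. by rewrite /free_lift mmapU mul_malgC scale1r fmU big_seq1. Qed.
End FreeAlgebra.

Record alg_hom (R : comNzRingType) (A B : assocAlgType R) := AlgHom {
  alg_fun :> {rmorphism A -> B};
  alg_fun_scal : forall c : R, alg_fun (scal c) = scal c
}.

Definition representation (R : comNzRingType) (A : assocAlgType R) (n : nat) :=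
  alg_hom A 'M[R]_n.

Section QuotientAlgebra.
Variables (R : comNzRingType) (A : assocAlgType R) (S : A -> Prop).

Inductive two_sided_ideal : A -> Prop :=
| ideal_gen x : S x -> two_sided_ideal x
| ideal_0 : two_sided_ideal 0
| ideal_add x y :
    two_sided_ideal x -> two_sided_ideal y -> two_sided_ideal (x + y)
| ideal_mull a x : two_sided_ideal x -> two_sided_ideal (a * x)
| ideal_mulr a x : two_sided_ideal x -> two_sided_ideal (x * a).

Definition ideal_pred : {pred A} := fun x => `[< two_sided_ideal x >].

Lemma ideal_predP x : reflect (two_sided_ideal x) (x \in ideal_pred).
Proof. exact: asboolP. Qed.

Fact ideal_pred_zmod : zmod_closed ideal_pred.
Proof.
split; first by apply/ideal_predP; exact: ideal_0.
move=> x y /ideal_predP Ix /ideal_predP Iy; apply/ideal_predP.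
by rewrite -mulN1r; apply/ideal_add/ideal_mull.
Qed.

HB.instance Definition _ := GRing.isZmodClosed.Build A ideal_pred
  ideal_pred_zmod.

Definition quot_alg := Quotient.quot ideal_pred.

HB.instance Definition _ := GRing.Zmodule.on quot_alg.
HB.instance Definition _ := Quotient.on quot_alg.

Definition quot_proj (x : A) : quot_alg := \pi_(Quotient.quot ideal_pred) x.

Fact quot_projP x y :
  reflect (two_sided_ideal (x - y)) (quot_proj x == quot_proj y).
Proof. by rewrite /quot_proj -Quotient.idealrBE; exact: ideal_predP. Qed.

Definition quot_repr (x : quot_alg) : A := repr x.

Fact quot_reprK : cancel quot_repr quot_proj.
Proof. exact: reprK. Qed.

Fact quot_proj_zmod : zmod_morphism quot_proj.
Proof. by move=> x y; rewrite /quot_proj !piE. Qed.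

HB.instance Definition _ := GRing.isZmodMorphism.Build A quot_alg quot_proj
  quot_proj_zmod.

Definition quot_one : quot_alg := quot_proj 1.
Definition quot_mul (x y : quot_alg) : quot_alg :=
  quot_proj (quot_repr x * quot_repr y).

Fact quot_projM x y : quot_proj (x * y) = quot_mul (quot_proj x) (quot_proj y).
Proof.
apply/eqP/quot_projP.
set x' := quot_repr _; set y' := quot_repr _.
have Ix : two_sided_ideal (x - x') by apply/quot_projP; rewrite quot_reprK.
have Iy : two_sided_ideal (y - y') by apply/quot_projP; rewrite quot_reprK.
have -> : x * y - x' * y' = (x - x') * y + x' * (y - y').
  by rewrite mulrBl mulrBr addrA subrK.
by apply: ideal_add; [exact: ideal_mulr | exact: ideal_mull].
Qed.

Fact quot_mulA : associative quot_mul.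
Proof.
move=> x y z; rewrite -[x]quot_reprK -[y]quot_reprK -[z]quot_reprK.
by rewrite -!quot_projM mulrA.
Qed.

Fact quot_mul1 : left_id quot_one quot_mul.
Proof. by move=> x; rewrite -[x]quot_reprK -quot_projM mul1r. Qed.

Fact quot_mulr1 : right_id quot_one quot_mul.
Proof. by move=> x; rewrite -[x]quot_reprK -quot_projM mulr1. Qed.

Fact quot_mulDl : left_distributive quot_mul +%R.
Proof.
move=> x y z; rewrite -[x]quot_reprK -[y]quot_reprK -[z]quot_reprK.
by rewrite -raddfD -!quot_projM mulrDl raddfD.
Qed.

Fact quot_mulDr : right_distributive quot_mul +%R.
Proof.
move=> x y z; rewrite -[x]quot_reprK -[y]quot_reprK -[z]quot_reprK.
by rewrite -raddfD -!quot_projM mulrDr raddfD.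
Qed.

HB.instance Definition _ := GRing.Zmodule_isPzRing.Build quot_alg
  quot_mulA quot_mul1 quot_mulr1 quot_mulDl quot_mulDr.

Fact quot_proj_monoid : monoid_morphism quot_proj.
Proof. by split=> // x y; exact: quot_projM. Qed.

HB.instance Definition _ := GRing.isMonoidMorphism.Build A quot_alg quot_proj
  quot_proj_monoid.

Definition quot_scal (c : R) : quot_alg := quot_proj (scal c).

Fact quot_scal_zmod : zmod_morphism quot_scal.
Proof. by move=> c d; rewrite /quot_scal !rmorphB. Qed.

Fact quot_scal_monoid : monoid_morphism quot_scal.
Proof. by split=> [|c d]; rewrite /quot_scal ?rmorph1 ?rmorphM. Qed.

Fact quot_scal_central c (x : quot_alg) : quot_scal c * x = x * quot_scal c.
Proof. by rewrite -[x]quot_reprK -!rmorphM scal_central. Qed.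

HB.instance Definition _ := hasScalars.Build R quot_alg
  quot_scal_zmod quot_scal_monoid quot_scal_central.
End QuotientAlgebra.

Section SubAlgebra.
Variables (R : comNzRingType) (A : assocAlgType R) (S : A -> Prop).

Inductive generated_subalg : A -> Prop :=
| subalg_gen x : S x -> generated_subalg x
| subalg_scal c : generated_subalg (scal c)
| subalg_add x y :
    generated_subalg x -> generated_subalg y -> generated_subalg (x + y)
| subalg_mul x y :
    generated_subalg x -> generated_subalg y -> generated_subalg (x * y).

Definition subalg_pred : {pred A} := fun x => `[< generated_subalg x >].

Lemma subalg_predP x : reflect (generated_subalg x) (x \in subalg_pred).
Proof. exact: asboolP. Qed.

Fact subalg_pred_subring : subring_closed subalg_pred.
Proof.
split=> [|x y /subalg_predP Ax /subalg_predP Ay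
         |x y /subalg_predP Ax /subalg_predP Ay]; apply/subalg_predP.
- by rewrite -(rmorph1 (@scal R A)); exact: subalg_scal.
- rewrite -mulN1r -(rmorphN1 (@scal R A)).
  by apply/subalg_add/subalg_mul => //; exact: subalg_scal.
- exact: subalg_mul.
Qed.

HB.instance Definition _ := GRing.isSubringClosed.Build A subalg_pred
  subalg_pred_subring.

Definition subalg := {x : A | x \in subalg_pred}.

HB.instance Definition _ := SubChoice.on subalg.
HB.instance Definition _ := GRing.SubChoice_isSubPzRing.Build A subalg_pred
  subalg subalg_pred_subring.

Fact scal_in_subalg c : scal c \in subalg_pred.
Proof. by apply/subalg_predP; exact: subalg_scal. Qed.

Definition sub_scal (c : R) : subalg := exist _ (scal c) (scal_in_subalg c).

Fact sub_scal_zmod : zmod_morphism sub_scal.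
Proof. by move=> c d; apply: val_inj; rewrite /= rmorphB. Qed.

Fact sub_scal_monoid : monoid_morphism sub_scal.
Proof. by split=> [|c d]; apply: val_inj; rewrite /= ?rmorph1 ?rmorphM. Qed.

Fact sub_scal_central c (x : subalg) : sub_scal c * x = x * sub_scal c.
Proof. by apply: val_inj; rewrite /= scal_central. Qed.

HB.instance Definition _ := hasScalars.Build R subalg
  sub_scal_zmod sub_scal_monoid sub_scal_central.

Fact subalg_gen_in x : S x -> x \in subalg_pred.
Proof. by move=> Sx; apply/subalg_predP; exact: subalg_gen. Qed.

Definition to_subalg x (Sx : S x) : subalg := exist _ x (subalg_gen_in Sx).
End SubAlgebra.

(* [n]_e, [n]_e! and the Gaussian binomial. The latter is a Laurent           *)
(* polynomial in e, still meaningful when some [k]_e vanishes; hence the      *)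
(* Pascal recursion, with [gauss_binE] relating it to the quotient formula.   *)
Section QuantumNumbers.
Variables (C : fieldType) (e : C).

Definition qnum (c : nat) : C := (e ^+ c - e ^- c) / (e - e^-1).

Definition qfact (c : nat) : C := \prod_(1 <= k < c.+1) qnum k.

Fixpoint gauss_bin (c d : nat) : C :=
  match c, d with
  | _, 0 => 1
  | 0, _.+1 => 0
  | c'.+1, d'.+1 =>
      e ^+ d'.+1 * gauss_bin c' d'.+1 + e ^- (c' - d') * gauss_bin c' d'
  end.

Lemma gauss_bin_small c d : (c < d)%N -> gauss_bin c d = 0.
Proof.
elim: c d => [|c IHc] [|d] //=; rewrite ltnS => cd.
by rewrite !IHc // ?mulr0 ?addr0 // ltnW.
Qed.

Lemma qnumD a b : e != 0 -> qnum (a + b) = e ^+ b * qnum a + e ^- a * qnum b.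
Proof.
move=> e0; rewrite /qnum !mulrA -mulrDl; congr (_ / _).
rewrite !mulrBr !exprD invfM -[in RHS]exprVn -!exprVn.
have -> : e ^+ b * e ^+ a = e ^+ a * e ^+ b by rewrite mulrC.
have -> : e ^+ b * e^-1 ^+ a = e^-1 ^+ a * e ^+ b by rewrite mulrC.
by rewrite addrA subrK.
Qed.

Lemma gauss_binE a b : e != 0 ->
  gauss_bin (a + b) b * (qfact b * qfact a) = qfact (a + b).
Proof.
move=> e0.
have factS k : qfact k.+1 = qfact k * qnum k.+1 by rewrite /qfact big_nat_recr.
have fact0 : qfact 0 = 1 by rewrite /qfact big_geq.
have [s] : exists s, (a + b <= s)%N by exists (a + b)%N.
elim: s a b => [|s IHs] a b.
  by rewrite leqn0 addn_eq0 => /andP[/eqP-> /eqP->]; rewrite /= fact0 !mulr1.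
case: b => [|b]; first by rewrite addn0 fact0 mul1r; case: a => [|a] _ /=; rewrite mul1r.
rewrite addnS ltnS => le_s; rewrite /= addnK mulrDl [in RHS]factS.
have -> : qnum (a + b).+1 = e ^+ b.+1 * qnum a + e ^- a * qnum b.+1.
  by rewrite -addnS qnumD.
rewrite mulrDr; congr (_ + _).
- case: a le_s => [|a] le_s.
    by rewrite gauss_bin_small // mulr0 mul0r /qnum expr0 invr1 subrr mul0r !mulr0.
  have := IHs a b.+1; rewrite addnS addSn in le_s *; move=> /(_ le_s) <-.
  by rewrite [qfact a.+1]factS; ring.
- by rewrite -(IHs a b le_s) [qfact b.+1]factS; ring.
Qed.
End QuantumNumbers.

(* Cartan matrix a_ij = 2(alpha_i|alpha_j)/(alpha_i|alpha_i) of a simple Lie  *)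
(* algebra of rank n: indecomposable of finite type. Its symmetrizer is       *)
(* d_i = (alpha_i|alpha_i)/2, equal to 1 on short simple roots.               *)
Record simple_cartan (n : nat) := SimpleCartan {
  cartan_mx :> 'M[int]_n;
  half_norm : 'I_n -> nat;
  rank_gt0 : (0 < n)%N;
  cartan_diag : forall i, cartan_mx i i = 2;
  cartan_offdiag : forall i j, i != j -> cartan_mx i j <= 0;
  cartan_sym : forall i j,
    (half_norm i)%:Z * cartan_mx i j = (half_norm j)%:Z * cartan_mx j i;
  half_norm_gt0 : forall i, (0 < half_norm i)%N;
  half_norm_short : exists i, half_norm i = 1%N;
  cartan_posdef : forall x : 'rV[int]_n, x != 0 ->
    0 < \sum_i \sum_j (half_norm i)%:Z * cartan_mx i j * x 0 i * x 0 j;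
  cartan_indecomposable : forall J : {set 'I_n}, J != finset.set0 ->
    (forall i j, i \in J -> j \notin J -> cartan_mx i j = 0) -> J = [set: 'I_n]
}.

Definition is_G2 n (A : simple_cartan n) :=
  n = 2%N /\ exists i j, A i j = -1 /\ A j i = -3.

(* The weight lattice is 'rV[int]_n, mu being identified with its coordinates *)
(* mu 0 i = <mu, alpha_i^vee> on the fundamental weights.                     *)
Section Weights.
Variables (n : nat) (A : simple_cartan n).

Definition simple_root (i : 'I_n) : 'rV[int]_n := \row_j A j i.

Definition pair_root (mu : 'rV[int]_n) (i : 'I_n) : int :=
  (half_norm A i)%:Z * mu 0 i.

Definition simple_refl (i : 'I_n) (mu : 'rV[int]_n) : 'rV[int]_n :=
  mu - mu 0 i *: simple_root i.

Definition weyl_act (w : seq 'I_n) (mu : 'rV[int]_n) : 'rV[int]_n :=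
  foldr simple_refl mu w.

Definition reduced_word (w : seq 'I_n) :=
  forall w', weyl_act w' =1 weyl_act w -> (size w <= size w')%N.

Definition reduced_word_w0 (w : seq 'I_n) :=
  reduced_word w /\ forall w', reduced_word w' -> (size w' <= size w)%N.

Definition is_root (b : 'rV[int]_n) :=
  exists w i, b = weyl_act w (simple_root i).

(* For w = i_1 ... i_N: the roots s_{i_1} ... s_{i_{k-1}} alpha_{i_k}.        *)
Fixpoint word_roots (w : seq 'I_n) : seq 'rV[int]_n :=
  if w is i :: w' then simple_root i :: map (simple_refl i) (word_roots w')
  else [::].

Record lattice := Lattice {
  lattice_pred :> {pred 'rV[int]_n};
  lattice_zmod : zmod_closed lattice_pred;
  lattice_root : forall i, simple_root i \in lattice_pred
}.

HB.instance Definition _ (M : lattice) :=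
  GRing.isZmodClosed.Build 'rV[int]_n (lattice_pred M) (lattice_zmod M).

Definition weight (M : lattice) := {mu : 'rV[int]_n | mu \in lattice_pred M}.

HB.instance Definition _ M := SubChoice.on (weight M).
HB.instance Definition _ M := [SubChoice_isSubZmodule of weight M by <:].

Definition root_weight (M : lattice) (i : 'I_n) : weight M :=
  exist _ (simple_root i) (lattice_root M i).

Definition refl_weight (M : lattice) (i : 'I_n) (mu : weight M) : weight M :=
  mu - root_weight M i *~ val mu 0 i.

Definition in_root_lattice (M : lattice) (mu : weight M) :=
  exists c : 'I_n -> int, mu = \sum_i root_weight M i *~ c i.

Definition root_lattice_cosets (M : lattice) : set (set (weight M)) :=
  [set [set nu | in_root_lattice (nu - mu)] | mu in setT]%classic.
End Weights.

Arguments root_lattice_cosets {n A} M.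

Section QuantumGroup.
Variables (C : fieldType) (n : nat) (A : simple_cartan n) (M : lattice A).
Variable eps : C.

Definition eps_root (i : 'I_n) : C := eps ^+ half_norm A i.

Definition generator : choiceType := ('I_n + 'I_n + weight M)%type.
Definition free_alg := {malg C[{fmonom generator}]}.

Definition freeE (i : 'I_n) : free_alg :=
  free_gen C (inl (inl i) : generator).
Definition freeF (i : 'I_n) : free_alg :=
  free_gen C (inl (inr i) : generator).
Definition freeK (mu : weight M) : free_alg :=
  free_gen C (inr mu : generator).

Definition serre (x : 'I_n -> free_alg) (i j : 'I_n) : free_alg :=
  let r := absz (1 - A i j) in
  \sum_(a < r.+1) ((-1) ^+ a * gauss_bin (eps_root i) r a) *:
    (x i ^+ a * x j * x i ^+ (r - a)).

(* A relator x stands for the relation x = 0.                                 *)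
Inductive quantum_relator : free_alg -> Prop :=
| rel_K0 : quantum_relator (freeK 0 - 1)
| rel_KD mu nu : quantum_relator (freeK mu * freeK nu - freeK (mu + nu))
| rel_KE mu i : quantum_relator
    (freeK mu * freeE i - eps ^ pair_root A (val mu) i *: (freeE i * freeK mu))
| rel_KF mu i : quantum_relator
    (freeK mu * freeF i
     - eps ^ (- pair_root A (val mu) i) *: (freeF i * freeK mu))
| rel_EF i j : quantum_relator
    (freeE i * freeF j - freeF j * freeE i
     - (if i == j then (eps_root i - (eps_root i)^-1)^-1 *:
          (freeK (root_weight M i) - freeK (- root_weight M i)) else 0))
| rel_serreE i j : i != j -> quantum_relator (serre freeE i j)
| rel_serreF i j : i != j -> quantum_relator (serre freeF i j).

Definition Ueps : assocAlgType C := quot_alg quantum_relator.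
Definition Uproj (x : free_alg) : Ueps := quot_proj quantum_relator x.

(* Lusztig's automorphism T''_{i,1}, lifted to the free algebra; divided      *)
(* powers only occur with exponent at most 3.                                 *)
Definition divpow (i : 'I_n) (x : free_alg) (k : nat) : free_alg :=
  (qfact (eps_root i) k)^-1 *: x ^+ k.

Definition lusztig_gen (i : 'I_n) (g : generator) : free_alg :=
  match g with
  | inl (inl j) =>
      if j == i then - (freeF i * freeK (root_weight M i)) else
      let s := absz (A i j) in
      \sum_(r < s.+1) ((-1) ^+ r * eps_root i ^- r) *:
        (divpow i (freeE i) (s - r) * freeE j * divpow i (freeE i) r)
  | inl (inr j) =>
      if j == i then - (freeK (- root_weight M i) * freeE i) else
      let s := absz (A i j) in
      \sum_(r < s.+1) ((-1) ^+ r * eps_root i ^+ r) *: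
        (divpow i (freeF i) r * freeF j * divpow i (freeF i) (s - r))
  | inr mu => freeK (refl_weight i mu)
  end.

Definition lusztig_T (i : 'I_n) : free_alg -> free_alg :=
  free_lift (lusztig_gen i).

(* T_{i_1} ... T_{i_{k-1}} x_{i_k} for w = i_1 ... i_N and k = 1, ..., N.     *)
Fixpoint lusztig_roots (x : 'I_n -> free_alg) (w : seq 'I_n) : seq free_alg :=
  if w is i :: w' then x i :: map (lusztig_T i) (lusztig_roots x w')
  else [::].

Definition cartanK (mu : weight M) : Ueps := Uproj (freeK mu).

Lemma cartanKD mu nu : cartanK (mu + nu) = cartanK mu * cartanK nu.
Proof.
apply/esym/eqP; rewrite /cartanK /Uproj -rmorphM /=.
by apply/quot_projP/ideal_gen; exact: rel_KD.
Qed.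

Lemma cartanK0 : cartanK 0 = 1.
Proof.
apply/eqP; rewrite /cartanK /Uproj -(rmorph1 (quot_proj quantum_relator)).
by apply/quot_projP/ideal_gen; exact: rel_K0.
Qed.

Section LCenter.
Variables (ell : nat) (w : seq 'I_n).

Definition rootE (k : 'I_(size w)) : Ueps :=
  Uproj (nth 0 (lusztig_roots freeE w) k).
Definition rootF (k : 'I_(size w)) : Ueps :=
  Uproj (nth 0 (lusztig_roots freeF w) k).

Inductive lcenter_gen : Ueps -> Prop :=
| lcenter_E k : lcenter_gen (rootE k ^+ ell)
| lcenter_F k : lcenter_gen (rootF k ^+ ell)
| lcenter_K mu : lcenter_gen (cartanK mu ^+ ell).

Definition Z0 : assocAlgType C := subalg lcenter_gen.

Definition Z0E (k : 'I_(size w)) : Z0 := to_subalg (lcenter_E k).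
Definition Z0F (k : 'I_(size w)) : Z0 := to_subalg (lcenter_F k).
Definition Z0K (mu : weight M) : Z0 := to_subalg (lcenter_K mu).

Lemma Z0KD mu nu : Z0K (mu + nu) = Z0K mu * Z0K nu.
Proof.
apply: val_inj; rewrite /= cartanKD exprMn_comm //.
by rewrite /GRing.comm -!cartanKD addrC.
Qed.

Lemma Z0K0 : Z0K 0 = 1.
Proof. by apply: val_inj; rewrite /= cartanK0 expr1n. Qed.

Definition SpecZ0 := alg_hom Z0 C^o.

(* As Z0 is central, (ker eta) U is the two-sided ideal generated by ker eta. *)
Definition Ueta (eta : SpecZ0) : assocAlgType C :=
  quot_alg (fun x : Ueps => exists2 y : Z0, eta y = 0 & x = \val y).
End LCenter.
End QuantumGroup.

(* Realisation of G_M as a Chevalley group in GL_N, from a representation of  *)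
(* the simple Lie algebra in a basis of weight vectors whose weights generate *)
(* M. The Lie algebra is given by its Chevalley-Serre presentation.           *)
Section ChevalleyGroup.
Variables (C : fieldType) (n : nat) (A : simple_cartan n) (M : lattice A).
Variable N : nat.

Definition mx_bracket (X Y : 'M[C]_N) : 'M[C]_N := X *m Y - Y *m X.

Definition coroot_mx (wt : 'I_N -> weight M) (i : 'I_n) : 'M[C]_N :=
  diag_mx (\row_k (val (wt k) 0 i)%:~R).

Record chevalley_rep := ChevalleyRep {
  rep_weight : 'I_N -> weight M;
  rep_e : 'I_n -> 'M[C]_N;
  rep_f : 'I_n -> 'M[C]_N;
  rep_he : forall i j, mx_bracket (coroot_mx rep_weight i) (rep_e j)
                       = (A i j)%:~R *: rep_e j;
  rep_hf : forall i j, mx_bracket (coroot_mx rep_weight i) (rep_f j)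
                       = - (A i j)%:~R *: rep_f j;
  rep_ef : forall i j, mx_bracket (rep_e i) (rep_f j)
                       = if i == j then coroot_mx rep_weight i else 0;
  rep_serre_e : forall i j, i != j ->
    iter (absz (1 - A i j)) (mx_bracket (rep_e i)) (rep_e j) = 0;
  rep_serre_f : forall i j, i != j ->
    iter (absz (1 - A i j)) (mx_bracket (rep_f i)) (rep_f j) = 0;
  rep_weight_span : forall mu : weight M,
    exists c : 'I_N -> int, mu = \sum_k rep_weight k *~ c k
}.

Variable V : chevalley_rep.

Inductive lie_alg : 'M[C]_N -> Prop :=
| lie_e i : lie_alg (rep_e V i)
| lie_f i : lie_alg (rep_f V i)
| lie_scale c X : lie_alg X -> lie_alg (c *: X)
| lie_add X Y : lie_alg X -> lie_alg Y -> lie_alg (X + Y)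
| lie_bracket X Y : lie_alg X -> lie_alg Y -> lie_alg (mx_bracket X Y).

Definition root_space (b : 'rV[int]_n) (X : 'M[C]_N) :=
  lie_alg X /\
  forall i, mx_bracket (coroot_mx (rep_weight V) i) X = (b 0 i)%:~R *: X.

(* A choice of coordinates a |-> exp (a X_b) on all root subgroups.           *)
Definition root_vectors (X : 'rV[int]_n -> 'M[C]_N) :=
  forall b, is_root A b -> root_space b (X b) /\ X b != 0.

(* Exponential of a nilpotent matrix.                                         *)
Definition nilp_exp (X : 'M[C]_N) : 'M[C]_N :=
  \sum_(k < N) (k`!%:R)^-1 *: X ^+ k.

Inductive chevalley_group : 'M[C]_N -> Prop :=
| chev_1 : chevalley_group 1
| chev_exp b X : is_root A b -> root_space b X -> chevalley_group (nilp_exp X)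
| chev_mul g h :
    chevalley_group g -> chevalley_group h -> chevalley_group (g * h).

Definition chevalley_center (z : 'M[C]_N) :=
  chevalley_group z /\ forall g, chevalley_group g -> z * g = g * z.

(* The point t of T_M, seen as a character t of M, acting on V.               *)
Definition torus_mx (t : weight M -> C) : 'M[C]_N :=
  diag_mx (\row_k t (rep_weight V k)).

Section PiM.
Variables (eps : C) (ell : nat) (w : seq 'I_n).
Variables (X : 'rV[int]_n -> 'M[C]_N) (eta : SpecZ0 M eps ell w).

Definition word_root (k : 'I_(size w)) : 'rV[int]_n := nth 0 (word_roots A w) k.

Definition unip_neg : 'M[C]_N :=
  \prod_(k < size w) nilp_exp ((eta (Z0F M eps ell k) : C) *: X (- word_root k)).

Definition unip_pos : 'M[C]_N :=
  \prod_(k < size w) nilp_exp ((eta (Z0E M eps ell k) : C) *: X (word_root k)).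

Definition torus_part (mu : weight M) : C := eta (Z0K eps ell w mu).

Lemma torus_part_character :
  torus_part 0 = 1 /\
  forall mu nu, torus_part (mu + nu) = torus_part mu * torus_part nu.
Proof.
by split=> [|mu nu]; rewrite /torus_part ?Z0K0 ?rmorph1 // Z0KD rmorphM.
Qed.

Definition pi_M : 'M[C]_N :=
  invmx unip_neg * torus_mx torus_part ^+ 2 * unip_pos.
End PiM.

(* 0 for an element of infinite order.                                        *)
Definition mx_order (z : 'M[C]_N) : nat :=
  if pselect (exists k, (0 < k)%N && (z ^+ k == 1)) is left z_fin
  then ex_minn z_fin else 0%N.
End ChevalleyGroup.

(* Main.v *)
Require Import Defs.
From HB Require Import structures.
From mathcomp Require Import all_boot all_order all_algebra.
From mathcomp Require Import fingroup morphism quotient pgroup.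
From mathcomp Require cyclic.
From mathcomp Require Import boolp classical_sets functions cardinality reals.
From mathcomp Require Import complex monalg zify ring.

(** Write [t mu] for the value of [eta] at [K_mu ^ ell] and [Q] for the root
    lattice. In a one-dimensional representation the images of [E_i] and [F_i]
    commute, so the relation expressing [E_i F_i - F_i E_i] forces [K_i ^ 2 = 1].
    What is left is a character [chi] of [M] with [chi ^ 2 = 1] on [Q] and
    [chi ^ ell = t] ([character_of_representation]). Conversely such a [chi],
    extended by zero to all [E_i] and [F_i], respects every relation of the
    quantum group. It kills all root vectors, because these are homogeneous of
    nonzero degree for the grading by [Q]; it therefore factors through the
    reduced algebra as soon as [eta] vanishes on the [ell]-th powers of the root
    vectors ([representation_of_character]).

    That vanishing comes from the centrality of [z = u^-1 t^2 v]. A central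
    element commutes with the Chevalley generators, hence preserves the weight
    spaces. In [u z = t^2 v] the factor [u - 1] lowers the height of a weight and
    [v - 1] raises it, so that [u = v = 1] and [z = t^2] ([triangular_unique]).
    The roots attached to a reduced word are positive and pairwise distinct
    ([word_root_positive], [word_roots_neq]), so a product of their exponentials
    equals 1 only if all coordinates vanish ([prod_exp_eq1]). Finally [t^2] is
    trivial on [Q], since it commutes with every [e_i] ([pi_central]).

    Let [ell = 2 k + 1]. Then [chi |-> chi^2] and [y |-> t y^-k] are inverse
    bijections between the characters [chi] above and the characters [y] of
    [M / Q] with [y ^ ell = t^2]. So the question is whether [z], seen as a
    character of [M / Q], is an [ell]-th power. If it is, then [z ^ (m / d) = 1],
    because [m] divides [ell (m / d)]. The converse fails for a general abelian
    group of order [m], for instance one with two cyclic factors of order 3; it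
    holds because, away from primes not dividing [ell], [M / Q] is cyclic
    ([character_root]).

    This cyclicity is read off the Dynkin diagram ([weights_mod_roots_cyclic]).
    Positive definiteness forces the vertices that are not leaves to form a path.
    Starting from a leaf at one end of it, each relation
    [alpha_i = sum_j a_ji omega_j] expresses one more fundamental weight by the
    previous ones, up to inverting 2 or an off-diagonal Cartan integer; both are
    prime to [ell], the entry -3 occurring in type G2 only. *)

Set Implicit Arguments.
Unset Strict Implicit.
Unset Printing Implicit Defensive.

Import Order.TTheory GRing.Theory Num.Theory.
Local Open Scope ring_scope.

(** * Weights and characters *)

Section Weights.
Variables (n : nat) (A : simple_cartan n).

Lemma simple_reflD i mu nu :
  simple_refl A i (mu + nu) = simple_refl A i mu + simple_refl A i nu.
Proof. by rewrite /simple_refl mxE scalerDl opprD addrACA. Qed.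

Lemma simple_refl0 i : simple_refl A i 0 = 0.
Proof. by rewrite /simple_refl mxE scale0r subr0. Qed.

Lemma simple_reflN i mu : simple_refl A i (- mu) = - simple_refl A i mu.
Proof. by rewrite /simple_refl mxE scaleNr opprB opprK addrC. Qed.

Lemma simple_refl_root i j :
  simple_refl A i (simple_root A j) = simple_root A j - A i j *: simple_root A i.
Proof. by rewrite /simple_refl /simple_root mxE. Qed.

Lemma simple_refl_self i : simple_refl A i (simple_root A i) = - simple_root A i.
Proof.
rewrite simple_refl_root cartan_diag (_ : 2 = 1 + 1) // scalerDl scale1r.
by rewrite opprD addrA subrr add0r.
Qed.

Lemma simple_reflK i : involutive (simple_refl A i).
Proof.
by move=> mu; rewrite /simple_refl !mxE cartan_diag; apply/rowP => k; rewrite !mxE; ring.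
Qed.

Variable M : lattice A.

Lemma val_weightMz (x : weight M) (a : int) : val (x *~ a) = a *: val x.
Proof.
rewrite -[X in X *: _]intz scaler_int.
exact: (raddfMz (val : {additive weight M -> 'rV[int]_n})).
Qed.

Lemma val_weightMn (x : weight M) k : val (x *+ k) = val x *+ k.
Proof. exact: (raddfMn (val : {additive weight M -> 'rV[int]_n})). Qed.

Lemma val_weightB (x y : weight M) : val (x - y) = val x - val y.
Proof. exact: (raddfB (val : {additive weight M -> 'rV[int]_n})). Qed.
End Weights.

Section Characters.
Variables (C : fieldType) (n : nat) (A : simple_cartan n) (M : lattice A).

Definition weight_character (chi : weight M -> C) :=
  chi 0 = 1 /\ forall mu nu, chi (mu + nu) = chi mu * chi nu.

Lemma weight_characterX (chi : weight M -> C) k :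
  weight_character chi -> weight_character (fun mu => chi mu ^+ k).
Proof. by move=> [c0 cD]; split=> [|x y]; rewrite ?c0 ?expr1n // cD exprMn. Qed.

Variable chi : weight M -> C.
Hypothesis chiM : weight_character chi.

Lemma char_neq0 x : chi x != 0.
Proof.
have [c0 cD] := chiM; apply/eqP => cx; have := cD x (- x).
by rewrite subrr c0 cx mul0r => /eqP; rewrite oner_eq0.
Qed.

Lemma charN x : chi (- x) = (chi x)^-1.
Proof.
have [c0 cD] := chiM; apply: (mulfI (char_neq0 x)).
by rewrite -cD subrr c0 divff ?char_neq0.
Qed.

Lemma charMn x k : chi (x *+ k) = chi x ^+ k.
Proof.
have [c0 cD] := chiM.
by elim: k => [|k IH]; rewrite ?mulr0n ?expr0 // mulrS cD IH exprS.
Qed.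

Lemma charMz x (a : int) : chi (x *~ a) = chi x ^ a.
Proof.
case: a => k; first by rewrite -pmulrn charMn.
by rewrite NegzE mulrNz charN -pmulrn charMn exprnN.
Qed.

Lemma char_root_lattice : (forall i, chi (root_weight M i) = 1) ->
  forall x, in_root_lattice x -> chi x = 1.
Proof.
move=> h x [c ->]; have [c0 cD] := chiM.
by elim/big_rec: _ => // i y _ cy; rewrite cD cy mulr1 charMz h exp1rz.
Qed.
End Characters.

(** * Local shape of a Dynkin diagram of finite type *)

Section Cartan.
Variables (n : nat) (A : simple_cartan n).

(** Positive definiteness in the form used below: a nonzero nonnegative vector
    [x] with [(A x)_i <= 0] wherever [x_i <> 0] would give
    [sum_i d_i x_i (A x)_i <= 0]. Every forbidden subdiagram is excluded by
    exhibiting such an [x], and additional edges only make [A x] smaller. *)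
Lemma no_subharmonic (x : 'I_n -> int) :
  (forall i, 0 <= x i) -> (exists i, x i != 0) ->
  exists2 i, x i != 0 & 0 < \sum_j A i j * x j.
Proof.
move=> x_ge0 [i0 x_i0].
suff /existsP[i /andP[xi0 hi]] : [exists i, (x i != 0) && (0 < \sum_j A i j * x j)].
  by exists i.
apply: contraT => /existsPn h; exfalso.
have v0 : \row_i x i != 0.
  by apply: contraNneq x_i0 => /rowP /(_ i0); rewrite !mxE => ->.
have := cartan_posdef A v0.
suff : \sum_i \sum_j (half_norm A i)%:Z * A i j * (\row_i x i) 0 i * (\row_i x i) 0 j <= 0.
  by move=> le0 /lt_le_trans /(_ le0); rewrite ltxx.
apply: sumr_le0 => i _; under eq_bigr => j _ do rewrite !mxE.
have -> : \sum_j (half_norm A i)%:Z * A i j * x i * x j =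
    ((half_norm A i)%:Z * x i) * \sum_j A i j * x j.
  by rewrite mulr_sumr; apply: eq_bigr => j _; ring.
have := h i; rewrite negb_and negbK -leNgt => /orP[/eqP->|le0].
  by rewrite mulr0 mul0r.
by apply: mulr_ge0_le0 => //; apply: mulr_ge0.
Qed.

Definition adj (i j : 'I_n) := (i != j) && (A i j != 0).

Lemma cartan_eq0 i j : A i j = 0 -> A j i = 0.
Proof.
move=> Aij; have := cartan_sym A i j; rewrite Aij mulr0 => /esym/eqP.
by rewrite mulf_eq0 => /orP[|/eqP//]; have := half_norm_gt0 A j; lia.
Qed.

Lemma adj_sym i j : adj i j = adj j i.
Proof.
rewrite /adj eq_sym; congr (_ && ~~ _).
by apply/eqP/eqP; apply: cartan_eq0.
Qed.

Lemma adj_le i j : adj i j -> A i j <= -1.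
Proof. by case/andP=> /(@cartan_offdiag _ A) + /eqP; lia. Qed.

(** Each bond contributes at most -1, so forgetting the neighbours of [i]
    outside [s] and the multiplicities of bonds can only increase the row sum. *)
Lemma row_bound (x : 'I_n -> int) i (s : seq 'I_n) :
  (forall j, 0 <= x j) -> uniq s -> all (adj i) s ->
  \sum_j A i j * x j <= 2 * x i - \sum_(j <- s) x j.
Proof.
move=> x_ge0 s_uniq /allP s_adj; rewrite (bigD1 i) //= cartan_diag lerD2l.
rewrite big_uniq // -sumrN.
have si j : j \in s -> j != i by move/s_adj/andP=> [+ _]; rewrite eq_sym.
rewrite [leRHS](_ : _ = \sum_(j | j != i) if j \in s then - x j else 0); last first.
  rewrite -big_mkcondr; apply: eq_bigl => j.
  by apply/idP/andP => [js|[]//]; split; rewrite // si.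
apply: ler_sum => j ji; have [/s_adj/adj_le Aij|_] := ifPn.
  by have := x_ge0 j; nia.
by have := x_ge0 j; have := @cartan_offdiag _ A i j; rewrite eq_sym => /(_ ji); nia.
Qed.

Definition nbrs i := [set j | adj i j].
Definition hub i := (1 < #|nbrs i|)%N.

(** The diagram is a forest: on a subset where all vertices have two neighbours
    inside, the indicator vector would be subharmonic. *)
Lemma few_neighbors (J : {set 'I_n}) :
  J != finset.set0 -> exists2 i, i \in J & (#|nbrs i :&: J| <= 1)%N.
Proof.
case/finset.set0Pn => i0 Ji0.
have [|| i xi xi_gt0] := @no_subharmonic (fun i => (i \in J)%:R).
- by move=> i; case: (_ \in _).
- by exists i0; rewrite Ji0.
have Ji : i \in J by apply: contraNT xi => /negPf->.
have x_ge0 j : 0 <= (j \in J)%:R :> int by case: (_ \in _).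
have all_adj : all (adj i) (enum (nbrs i :&: J)).
  by apply/allP => j; rewrite mem_enum !inE => /andP[].
have := row_bound x_ge0 (enum_uniq _) all_adj.
rewrite Ji big_enum /=.
rewrite [X in _ - X](eq_bigr (fun=> 1)); last by move=> j; rewrite inE => /andP[_ ->].
rewrite sumr_const => h; exists i => //.
suff : (0 : int) < 2 - #|nbrs i :&: J|%:Z.
  by clear; move: #|_| => k; lia.
by apply: (lt_le_trans xi_gt0); rewrite -natz -[2]mulr1.
Qed.

(** Three neighbours that are not leaves would produce the affine diagram of
    type E6, with vertex [i] in the centre. *)
Lemma hub_neighbors i : (#|[set j in nbrs i | hub j]| <= 2)%N.
Proof.
rewrite leqNgt; apply/negP => /card_gt2P[a [b [c [[ha hb hc] [ab bc ca]]]]].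
have ex_nbr j : j \in [set j in nbrs i | hub j] -> exists2 k, adj j k & k != i.
  rewrite !inE => /andP[_ /card_gt1P[k [l [jk jl kl]]]].
  have [ki|ki] := eqVneq k i; last by exists k; rewrite // inE in jk.
  by exists l; [rewrite inE in jl | rewrite -ki eq_sym].
have adjP j : j \in [set j in nbrs i | hub j] -> adj i j by rewrite !inE => /andP[].
have [a' aa' ia'] := ex_nbr a ha; have [b' bb' ib'] := ex_nbr b hb.
have [c' cc' ic'] := ex_nbr c hc.
have ia := adjP a ha; have ib := adjP b hb; have ic := adjP c hc.
(* The null vector of the affine diagram of type E6. Should an outer vertex
   coincide with [a], [b], [c] or another outer vertex, the sums only decrease. *)
pose x u : int := if u == i then 3 else if u \in [:: a; b; c] then 2
  else if u \in [:: a'; b'; c'] then 1 else 0.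
have x_ge0 u : 0 <= x u by rewrite /x; do 3?case: ifP.
have ai : a != i by case/andP: ia; rewrite eq_sym.
have bi : b != i by case/andP: ib; rewrite eq_sym.
have ci : c != i by case/andP: ic; rewrite eq_sym.
have xi : x i = 3 by rewrite /x eqxx.
have xa : x a = 2 by rewrite /x (negPf ai) !inE eqxx.
have xb : x b = 2 by rewrite /x (negPf bi) !inE eqxx orbT.
have xc : x c = 2 by rewrite /x (negPf ci) !inE eqxx !orbT.
have x_ge1 u : u != i -> u \in [:: a'; b'; c'] -> 1 <= x u.
  by move=> ui hu; rewrite /x (negPf ui) hu; case: ifP.
have xa' : 1 <= x a' by rewrite x_ge1 // !inE eqxx.
have xb' : 1 <= x b' by rewrite x_ge1 // !inE eqxx orbT.
have xc' : 1 <= x c' by rewrite x_ge1 // !inE eqxx !orbT.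
have arm j j' : adj i j -> x j = 2 -> adj j j' -> j' != i -> 1 <= x j' ->
    \sum_k A j k * x k <= 0.
  move=> ij xj jj' j'i xj'; have := @row_bound x j [:: i; j'] x_ge0.
  rewrite /= inE eq_sym j'i /= !andbT adj_sym ij jj' => /(_ isT isT).
  rewrite !big_cons big_nil xi xj.
  by move: (\sum_k _) (x j') xj' => s y; clear; lia.
have tip j j' : adj j j' -> x j = 2 -> x j' = 1 -> \sum_k A j' k * x k <= 0.
  move=> jj' xj xj'; have := @row_bound x j' [:: j] x_ge0 isT.
  rewrite /= andbT adj_sym jj' => /(_ isT).
  rewrite big_cons big_nil xj xj'.
  by move: (\sum_k _) => s; clear; lia.
have [|u xu] := no_subharmonic x_ge0; first by exists i; rewrite xi.
rewrite ltNge => /negP; apply.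
have [ui|ui] := eqVneq u i.
  have := @row_bound x i [:: a; b; c] x_ge0; rewrite /= !inE negb_or ab bc.
  rewrite [a == c]eq_sym ca ia ib ic => /(_ isT isT).
  rewrite !big_cons big_nil ui xi xa xb xc.
  by move: (\sum_k _) => s; clear; lia.
have [uabc|uabc] := boolP (u \in [:: a; b; c]).
  move: uabc; rewrite !inE => /or3P[] /eqP->.
  - exact: (arm a a').
  - exact: (arm b b').
  - exact: (arm c c').
have [ut|ut] := boolP (u \in [:: a'; b'; c']); last first.
  by move: xu; rewrite /x (negPf ui) (negPf uabc) (negPf ut).
have xu1 : x u = 1 by rewrite /x (negPf ui) (negPf uabc) ut.
move: ut xu1; rewrite !inE => /or3P[] /eqP-> xu1.
- exact: (tip a).
- exact: (tip b).
- exact: (tip c).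
Qed.

(** The two-vertex case: the determinant [4 - a_ij a_ji] must be positive. *)
Lemma cartan_prod_lt4 i j : i != j -> A i j * A j i < 4.
Proof.
move=> ij; have Aij_le0 := cartan_offdiag A ij.
have [Aij|Aij] := eqVneq (A i j) 0; first by rewrite Aij mul0r.
rewrite ltNge; apply/negP => ge4.
(* This vector is orthogonal to row [i]; row [j] gives [4 - a_ij a_ji]. *)
pose x u : int := if u == i then - A i j else if u == j then 2 else 0.
have x_ge0 u : 0 <= x u by rewrite /x; do 2?case: ifP => // _; rewrite oppr_ge0.
have ji : j != i by rewrite eq_sym.
have xi : x i = - A i j by rewrite /x eqxx.
have xj : x j = 2 by rewrite /x (negPf ji) eqxx.
have row u : \sum_k A u k * x k = A u i * - A i j + A u j * 2.
  rewrite (bigD1 i) //= (bigD1 j) //= xi xj big1 ?addr0 // => k /andP[ki kj].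
  by rewrite /x (negPf ki) (negPf kj) mulr0.
have [|u xu] := no_subharmonic x_ge0; first by exists j; rewrite xj.
rewrite row; have [->|ui] := eqVneq u i; first by rewrite cartan_diag; lia.
have [->|uj] := eqVneq u j; first by rewrite cartan_diag; lia.
by move: xu; rewrite /x (negPf ui) (negPf uj).
Qed.

(** A triple bond cannot be extended: adding a vertex next to either end
    produces a diagram containing one of the two affine ones with a triple
    bond. *)
Lemma triple_bond_rank2 i j : A i j = -3 -> A j i = -1 -> n = 2%N.
Proof.
move=> Aij Aji.
have ij : i != j by apply/eqP => e; move: Aij; rewrite e cartan_diag.
have adj_ij : adj i j by rewrite /adj ij Aij.
have adj_ji : adj j i by rewrite adj_sym.
have no_third k (a b c : int) : k != i -> k != j ->
    0 < a -> 0 < b -> 0 < c ->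
    A i i * a + A i j * b + A i k * c <= 0 ->
    A j i * a + A j j * b + A j k * c <= 0 ->
    A k i * a + A k j * b + A k k * c <= 0 -> False.
  move=> ki kj a0 b0 c0 hi hj hk.
  pose x u : int := if u == i then a else if u == j then b else if u == k then c else 0.
  have x_ge0 u : 0 <= x u by rewrite /x; do 3?case: ifP => // _; apply: ltW.
  have xi : x i = a by rewrite /x eqxx.
  have xj : x j = b by rewrite /x eq_sym (negPf ij) eqxx.
  have xk : x k = c by rewrite /x (negPf ki) (negPf kj) eqxx.
  have row u : \sum_l A u l * x l = A u i * a + A u j * b + A u k * c.
    rewrite (bigD1 i) //= (bigD1 j) 1?eq_sym //= (bigD1 k) /= ?ki ?kj // xi xj xk.
    rewrite big1 ?addr0 ?addrA // => l /andP[/andP[li lj] lk].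
    by rewrite /x (negPf li) (negPf lj) (negPf lk) mulr0.
  have [|u xu] := no_subharmonic x_ge0; first by exists i; rewrite xi gt_eqF.
  rewrite row ltNge => /negP; apply; move: xu; rewrite /x.
  have [->|_] := eqVneq u i; first by [].
  have [->|_] := eqVneq u j; first by [].
  by have [->|_] := eqVneq u k.
have J_all : [set i; j] = [set: 'I_n].
  apply: (@cartan_indecomposable _ A) => [|u k].
    by apply/finset.set0Pn; exists i; rewrite !inE eqxx.
  rewrite !inE negb_or => u_ij /andP[ki kj].
  have ik : i != k by rewrite eq_sym.
  have jk : j != k by rewrite eq_sym.
  have [Aik|Aik] := eqVneq (A i k) 0.
    have [Ajk|Ajk] := eqVneq (A j k) 0; first by case/orP: u_ij => /eqP ->.
    exfalso; have /adj_le l1 : adj j k by rewrite /adj jk.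
    have /adj_le l2 : adj k j by rewrite adj_sym /adj jk.
    (* The third vertex is attached to [j] only. *)
    apply: (no_third k 3 2 1) => //; rewrite ?cartan_diag ?Aij ?Aji ?Aik //.
    - by rewrite -[leRHS]add0r; lia.
    - by rewrite (cartan_eq0 Aik); lia.
  exfalso; have /adj_le l1 : adj i k by rewrite /adj ik.
  have /adj_le l2 : adj k i by rewrite adj_sym /adj ik.
  have l3 := cartan_offdiag A kj; have l4 := cartan_offdiag A jk.
  (* The third vertex is attached to [i], and possibly to [j] as well. *)
  by apply: (no_third k 2 1 1) => //; rewrite ?cartan_diag ?Aij ?Aji //; lia.
have := cards2 i j; rewrite J_all cardsT card_ord => ->.
by rewrite ij.
Qed.

Lemma coprime_entry (ell : nat) i j : odd ell -> (is_G2 A -> coprime ell 3) ->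
  adj i j -> coprime ell `|A i j|.
Proof.
move=> ell_odd ellG2 ij; have /adj_le l1 := ij.
have /adj_le l2 : adj j i by rewrite adj_sym.
have ji : i != j by case/andP: ij.
have lt4 := cartan_prod_lt4 ji.
have [|[|]] : A i j = -1 \/ A i j = -2 \/ (A i j = -3 /\ A j i = -1) by nia.
- by move=> ->; rewrite coprimen1.
- by move=> ->; rewrite coprimen2.
move=> [Aij Aji]; rewrite Aij; apply: ellG2; split; last by exists j, i.
exact: triple_bond_rank2 Aij Aji.
Qed.

(** Neighbours satisfy [d_k a_kl = d_l a_lk] with entries prime to [ell], so
    the vertices at which a prime divisor of [ell] divides [d] form a union of
    components of a connected diagram; it misses the short roots. *)
Lemma coprime_half_norm (ell : nat) i : odd ell -> (is_G2 A -> coprime ell 3) ->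
  coprime ell (half_norm A i).
Proof.
move=> ell_odd ellG2; have ell_gt0 : (0 < ell)%N by case: (ell) ell_odd.
rewrite coprime_has_primes ?half_norm_gt0 //; apply/hasPn => p.
rewrite !mem_primes half_norm_gt0 => /and3P[p_pr _ pi]; rewrite p_pr ell_gt0 /=.
apply/negP => pl.
pose J := [set k | ~~ (p %| half_norm A k)%N].
have : J = [set: 'I_n].
  apply: (@cartan_indecomposable _ A) => [|k l].
    have [k hk] := half_norm_short A; apply/finset.set0Pn; exists k.
    by rewrite inE hk dvdn1 neq_ltn prime_gt1 ?orbT.
  rewrite !inE negbK => pk pl'; apply/eqP; apply: contraNT pk => Akl.
  have [e|kl] := eqVneq k l; first by rewrite e.
  have cop : coprime p `|A k l|.
    by apply: coprime_dvdl pl _; apply: coprime_entry; rewrite // /adj kl.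
  rewrite -(Gauss_dvdl _ cop); have := congr1 absz (cartan_sym A k l).
  by rewrite !abszM => ->; apply: dvdn_mulr.
by move/setP/(_ i); rewrite !inE pi.
Qed.

(** * Cyclicity of the weight lattice modulo the root lattice *)

(** Think of [S] as the fundamental weights already reached through simple
    roots: a vertex of [S] with a single neighbour outside [S] reaches that
    neighbour, and a leaf next to [S] is reached through its own root. The hubs
    form a path, and the propagation starts at a leaf attached to one of its ends
    (at any vertex if there is no hub). *)
Lemma zero_forcing : exists r, forall S : {set 'I_n}, r \in S ->
  (forall i j, i \in S -> adj i j ->
     (forall k, adj i k -> k != j -> k \in S) -> j \in S) ->
  (forall i j, i \in S -> adj i j -> ~~ hub j -> j \in S) ->
  S = [set: 'I_n].
Proof.
have not_hub i j k : ~~ hub i -> adj i j -> adj i k -> k = j.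
  move=> hi ij ik; apply: contraNeq hi => kj.
  by apply/card_gt1P; exists k, j; split; rewrite // inE.
pose H := [set i | hub i].
have [H0|H_neq0] := eqVneq H finset.set0.
  exists (Ordinal (rank_gt0 A)) => S rS step leaf.
  apply: (@cartan_indecomposable _ A) => [|i j iS jS].
    by apply/finset.set0Pn; eexists; exact: rS.
  apply: contraNeq (jS) => Aij; have ij : adj i j.
    by rewrite /adj Aij andbT; apply: contraNneq jS => <-.
  apply: leaf ij _ => //.
  by have /setP/(_ j) := H0; rewrite !inE => ->.
have [r rH r_le1] := few_neighbors H_neq0.
have hub_r : hub r by rewrite inE in rH.
have [r' rr' hub_r'] : exists2 r', adj r r' & ~~ hub r'.
  apply/exists_inP; apply: contraLR r_le1 => /exists_inPn no_leaf.
  rewrite -ltnNge (leq_trans hub_r) // subset_leq_card //.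
  apply/fintype.subsetP => j rj; rewrite inE rj inE.
  by move: rj; rewrite inE => /no_leaf; rewrite negbK.
exists r' => S r'S step leaf.
have rS : r \in S.
  apply: (step r'); rewrite // 1?adj_sym // => k r'k kr.
  have r'r : adj r' r by rewrite adj_sym.
  by rewrite (not_hub _ _ _ hub_r' r'r r'k) eqxx in kr.
(* [T0] collects the hubs of [S] reached along the path of hubs: when one of
   them is visited, at most one of its neighbouring hubs is still missing. *)
pose T0 := [set i in S | hub i && ((i == r) || [exists k, [&& adj i k, hub k & k \in S]])].
pose T := [set j | (j \in T0) || ~~ hub j && [exists i, (i \in T0) && adj i j]].
have T0_step i j : i \in T0 -> adj i j -> hub j -> j \in T0.
  rewrite !inE => /and3P[iS hub_i i_cond] ij hub_j.
  have hji : [exists k, [&& adj j k, hub k & k \in S]].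
    by apply/existsP; exists i; rewrite adj_sym ij hub_i iS.
  rewrite hub_j hji orbT !andbT; apply: contraT => jS.
  case/negP: (jS); apply: (step i) => // k ik kj.
  have [hub_k|] := boolP (hub k); last by apply: leaf ik.
  case/orP: i_cond => [/eqP e|/existsP[l /and3P[il hub_l lS]]].
    move: r_le1; rewrite leqNgt => /negP[]; apply/card_gt1P; exists k, j.
    by rewrite !inE -e ik ij hub_k hub_j.
  have [->//|kl] := eqVneq k l.
  have jl : j != l by apply: contraNneq jS => ->.
  have := hub_neighbors i; rewrite leqNgt => /negP[].
  apply/card_gt2P; exists k, j, l; split; last by rewrite kj jl eq_sym kl.
  by rewrite !inE ik ij il hub_k hub_j hub_l.
have T_all : T = [set: 'I_n].
  apply: (@cartan_indecomposable _ A) => [|i j iT jT].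
    by apply/finset.set0Pn; exists r; rewrite !inE rS hub_r eqxx.
  apply: contraNeq (jT) => Aij; have ij : adj i j.
    by rewrite /adj Aij andbT; apply: contraNneq jT => <-.
  rewrite inE in iT; case/orP: iT => [iT0|/andP[hub_i /existsP[k /andP[kT0 ki]]]].
    rewrite inE; have [hub_j|hub_j] := boolP (hub j); first by rewrite (T0_step i).
    by apply/orP; right; apply/existsP; exists i; rewrite iT0.
  have <- : k = j by apply: not_hub hub_i ij _; rewrite adj_sym.
  by rewrite inE kT0.
apply/setP => j; rewrite inE; have /setP/(_ j) := T_all; rewrite !inE.
have T0S i : i \in T0 -> i \in S by rewrite inE => /andP[].
case/orP => [/and3P[]//|/andP[hub_j /existsP[i /andP[/T0S iS ij]]]].
exact: leaf ij hub_j.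
Qed.

Lemma simple_root_sum i : simple_root A i = \sum_j A j i *: delta_mx 0 j.
Proof.
apply/rowP => k; rewrite [LHS]mxE summxE (bigD1 k) //= big1 => [|j jk].
  by rewrite !mxE !eqxx mulr1 addr0.
by rewrite !mxE eq_sym (negPf jk) andbF mulr0.
Qed.

(** The weights having a multiple prime to [ell] in [Z omega + Q] form a group
    stable under division by integers prime to [ell]; along the propagation of
    [zero_forcing] it acquires every fundamental weight. *)
Lemma weights_mod_roots_cyclic (ell : nat) : odd ell ->
  (is_G2 A -> coprime ell 3) ->
  exists omega N, coprime ell N /\ forall mu : 'rV[int]_n,
    exists (a : int) (c : 'I_n -> int),
      mu *+ N = a *: omega + \sum_i c i *: simple_root A i.
Proof.
move=> ell_odd ellG2; have [r hr] := zero_forcing.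
pose omega : 'rV[int]_n := delta_mx 0 r.
pose span mu := exists (a : int) (c : 'I_n -> int),
  mu = a *: omega + \sum_i c i *: simple_root A i.
have spanD mu nu : span mu -> span nu -> span (mu + nu).
  move=> [a [c ->]] [b [d ->]]; exists (a + b), (fun i => c i + d i).
  rewrite scalerDl addrACA -big_split; congr (_ + _).
  by apply: eq_bigr => i _; rewrite scalerDl.
have spanZ z mu : span mu -> span (z *: mu).
  move=> [a [c ->]]; exists (z * a), (fun i => z * c i).
  rewrite scalerDr scalerA scaler_sumr; congr (_ + _).
  by apply: eq_bigr => i _; rewrite scalerA.
pose L mu := exists2 N, coprime ell N & span (mu *+ N).
have LD mu nu : L mu -> L nu -> L (mu + nu).
  move=> [N1 c1 s1] [N2 c2 s2]; exists (N1 * N2)%N; first by rewrite coprimeMr c1.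
  rewrite mulrnDl mulrnA mulnC [nu *+ _]mulrnA -!(scaler_nat _ (_ *+ _)).
  by apply: spanD; apply: spanZ.
have LZ z mu : L mu -> L (z *: mu).
  by move=> [N cN s]; exists N; rewrite // scalerMnr; apply: spanZ.
have L_root i : L (simple_root A i).
  exists 1%N; first exact: coprimen1.
  exists 0, (fun j => (j == i)%:R); rewrite scale0r add0r mulr1n.
  rewrite (bigD1 i) //= eqxx scale1r big1 ?addr0 // => j /negPf->.
  by rewrite scale0r.
have L0 : L 0 by rewrite -(scale0r (simple_root A r)); exact/LZ/L_root.
have L_div z mu : coprime ell `|z| -> L (z *: mu) -> L mu.
  move=> cz [N cN s]; exists (`|z| * N)%N; first by rewrite coprimeMr cz.
  have -> : mu *+ (`|z| * N) = sgz z *: ((z *: mu) *+ N).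
    by rewrite scalerMnr scalerA -abszEsg mulnC mulrnA -(scaler_nat `|z|%N) natz.
  exact: spanZ.
pose S := [set j | `[< L (delta_mx 0 j) >]].
have SL j : j \in S -> L (delta_mx 0 j) by rewrite inE => /asboolP.
have LS j : L (delta_mx 0 j) -> j \in S by move=> h; rewrite inE; apply/asboolP.
have L_sum (P : pred 'I_n) (F : 'I_n -> int) :
    (forall j, P j -> F j != 0 -> j \in S) -> L (\sum_(j | P j) F j *: delta_mx 0 j).
  move=> h; elim/big_rec: _ => [|j mu Pj Lmu]; first exact: L0.
  apply: LD => //; have [->|Fj] := eqVneq (F j) 0.
    by rewrite scale0r; exact: L0.
  by apply/LZ/SL/h.
have L_entry i j : coprime ell `|A j i| -> (forall k, k != j -> A k i != 0 -> k \in S) ->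
    j \in S.
  move=> cji hk; apply/LS/(L_div (A j i)) => //.
  have -> : A j i *: delta_mx 0 j =
      simple_root A i + (-1) *: \sum_(k | k != j) A k i *: delta_mx 0 k :> 'rV[int]_n.
    by rewrite simple_root_sum (bigD1 j) //= scaleN1r addrK.
  by apply: LD => //; apply: LZ; apply: L_sum => k; exact: hk.
have S_all : S = [set: 'I_n].
  apply: hr => [|i j iS ij nb|i j iS ij nj].
  - apply: LS; exists 1%N; first exact: coprimen1.
    exists 1, (fun=> 0); rewrite scale1r big1 ?addr0 // => i _.
    by rewrite scale0r.
  - apply: (L_entry i).
      by apply: coprime_entry => //; rewrite adj_sym.
    move=> k kj Aki; have [->//|ki] := eqVneq k i.
    by apply: nb => //; rewrite adj_sym /adj ki.
  - apply: (L_entry j); first by rewrite cartan_diag coprimen2.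
    move=> k kj Akj; have jk : adj j k by rewrite adj_sym /adj kj.
    suff -> : k = i by [].
    apply: contraNeq nj => ki; apply/card_gt1P; exists k, i.
    by split; rewrite // inE // adj_sym.
have L_all mu : L mu.
  rewrite [mu]row_sum_delta; apply: L_sum => j _ _; by rewrite S_all inE.
have /fin_all_exists2[N cN sN] : forall j : 'I_n, exists2 N, coprime ell N & span (delta_mx 0 j *+ N).
  by move=> j; apply: L_all.
exists omega, (\prod_j N j)%N; split.
  by elim/big_ind: _ => [||//]; [exact: coprimen1 | move=> x y; rewrite coprimeMr => -> ->].
move=> mu; suff : span (mu *+ (\prod_j N j)) by [].
rewrite [mu]row_sum_delta -sumrMnl.
have span_term (j : 'I_n) : span ((mu 0 j *: delta_mx 0 j) *+ (\prod_k N k)%N).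
  rewrite scalerMnr; apply/spanZ; rewrite (bigD1 j) //= mulrnA.
  by rewrite -(scaler_nat (\prod_(k | k != j) N k)%N); exact: spanZ.
move: (\prod_k N k)%N span_term => K span_term.
elim/big_rec: _ => [|j x _ hx]; last exact: spanD.
by exists 0, (fun=> 0); rewrite scale0r add0r big1 // => k _; exact: scale0r.
Qed.
End Cartan.

(** * Roots attached to a reduced word *)

Section Roots.
Variables (n : nat) (A : simple_cartan n).
Implicit Types (c : 'I_n -> int) (b mu : 'rV[int]_n).

Definition root_comb c : 'rV[int]_n := \sum_i c i *: simple_root A i.

Lemma root_combE c k : root_comb c 0 k = \sum_i c i * A k i.
Proof. by rewrite summxE; apply: eq_bigr => i _; rewrite !mxE. Qed.

Lemma root_comb_delta i : root_comb (fun k => (k == i)%:R) = simple_root A i.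
Proof.
rewrite /root_comb (bigD1 i) //= eqxx scale1r big1 ?addr0 // => k /negPf->.
exact: scale0r.
Qed.

Lemma root_comb_eq0 c : root_comb c = 0 -> forall i, c i = 0.
Proof.
move=> c0 i; apply/eqP; apply: contraT => ci.
have v0 : \row_k c k != 0.
  by apply: contraNneq ci => /rowP /(_ i); rewrite !mxE => ->.
have := cartan_posdef A v0; rewrite big1 ?ltxx // => k _.
have := root_combE c k; rewrite c0 => ck.
transitivity ((half_norm A k)%:Z * c k * \sum_l c l * A k l); last first.
  by rewrite -ck [X in _ * X]mxE mulr0.
by rewrite mulr_sumr; apply: eq_bigr => l _; rewrite !mxE; ring.
Qed.

Lemma root_comb_inj c c' : root_comb c = root_comb c' -> c =1 c'.
Proof.
move=> e i; apply/eqP; rewrite -subr_eq0; apply/eqP.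
apply: (@root_comb_eq0 (fun i => c i - c' i)); rewrite /root_comb.
under eq_bigr => k _ do rewrite scalerBl.
by rewrite sumrB -!/(root_comb _) e subrr.
Qed.

(** A height function with integral values: a row [x] with [x A] constant,
    obtained from the adjugate so that no division is needed. *)
Lemma height_exists : exists (x : 'I_n -> int) (D : int), 0 < D /\
  forall i, \sum_j x j * simple_root A i 0 j = D.
Proof.
(* A kernel vector of [A] would be isotropic. *)
have det0 : \det A != 0.
  rewrite -det_tr; apply/det0P => -[v v0 /rowP hv]; case/eqP: v0; apply/rowP => i.
  have h k : root_comb (v 0) 0 k = 0.
    rewrite root_combE; transitivity ((v *m A^T) 0 k); last by rewrite hv mxE.
    by rewrite mxE; apply: eq_bigr => l _; rewrite [X in _ = _ * X]mxE.
  by rewrite mxE; apply: root_comb_eq0; apply/rowP => k; rewrite h mxE.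
pose D : 'rV[int]_n := const_mx (\det A).
exists (fun j => (D *m \adj A) 0 j), (\det A ^+ 2).
split; first by rewrite exprn_even_gt0.
move=> i; under eq_bigr => j _ do rewrite [simple_root A i 0 j]mxE.
transitivity ((D *m \adj A *m A) 0 i); first by rewrite [RHS]mxE.
by rewrite -mulmxA mul_adj_mx mul_mx_scalar !mxE -expr2.
Qed.

(** The invariant form between a weight [mu] and the element [root_comb c] of
    the root lattice, in terms of [(mu | alpha_i) = d_i mu_i]. *)
Definition pairing mu c : int := \sum_i (half_norm A i)%:Z * c i * mu 0 i.

(** What the Weyl group preserves and the study of signs of roots rests on:
    integrality of the coordinates, the pairing with weights, and a divisibility
    which for a root [b] and [m = (b | b) / 2] says that [2 b / (b | b)] lies in
    the coroot lattice. *)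
Lemma weyl_act_comb w c : exists c',
  [/\ weyl_act A w (root_comb c) = root_comb c',
      forall mu, pairing (weyl_act A w mu) c' = pairing mu c &
      forall m : int, (forall i, (m %| (half_norm A i)%:Z * c i)%Z) ->
        forall i, (m %| (half_norm A i)%:Z * c' i)%Z].
Proof.
elim: w => [|k w [c' [e hp hd]]]; first by exists c.
pose B := root_comb c' 0 k.
have eB : B = \sum_l c' l * A k l by rewrite /B root_combE.
exists (fun i => c' i - B * (i == k)%:R); split=> [|mu|m hm i] /=.
- rewrite e /simple_refl -/B /root_comb.
  under [RHS]eq_bigr => i _ do rewrite scalerBl.
  rewrite sumrB; congr (_ - _).
  rewrite (bigD1 k) //= eqxx mulr1 big1 ?addr0 // => i /negPf->.
  by rewrite mulr0 scale0r.
- rewrite -hp; set nu := weyl_act A w mu; rewrite /pairing.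
  have dB : \sum_i (half_norm A i)%:Z * c' i * A i k = (half_norm A k)%:Z * B.
    rewrite eB mulr_sumr; apply: eq_bigr => l _.
    by rewrite mulrAC cartan_sym; ring.
  transitivity (\sum_i ((half_norm A i)%:Z * c' i * nu 0 i
     - nu 0 k * ((half_norm A i)%:Z * c' i * A i k)
     - (half_norm A i)%:Z * B * nu 0 i * (i == k)%:R
     + (half_norm A i)%:Z * B * nu 0 k * A i k * (i == k)%:R)).
    by apply: eq_bigr => i _; rewrite /simple_refl /simple_root !mxE; ring.
  rewrite big_split /= !sumrB -mulr_sumr dB.
  have sk (F : 'I_n -> int) : \sum_i F i * (i == k)%:R = F k.
    by rewrite (bigD1 k) //= eqxx mulr1 big1 ?addr0 // => i /negPf->; rewrite mulr0.
  by rewrite !sk cartan_diag; ring.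
- rewrite mulrBr; have [->|_] := eqVneq i k; last by rewrite !mulr0 subr0; apply: hd.
  rewrite mulr1; apply: rpredB; first exact: hd.
  rewrite eB mulr_sumr; apply: rpred_sum => l _.
  rewrite mulrCA cartan_sym mulrCA mulrA.
  by apply: dvdz_mulr; apply: hd.
Qed.

Definition positive b := exists c,
  [/\ b = root_comb c, forall i, 0 <= c i & exists i, c i != 0].

Lemma positive_simple i : positive (simple_root A i).
Proof.
exists (fun k => (k == i)%:R); rewrite root_comb_delta; split=> [//|k|].
  by case: eqP.
by exists i; rewrite eqxx.
Qed.

Lemma positive_opp b : positive b -> ~ positive (- b).
Proof.
move=> [c [e c0 [i ci]]] [c' [e' c'0 _]].
have h : root_comb (fun k => c k + c' k) = 0.
  rewrite /root_comb; under eq_bigr => k _ do rewrite scalerDl.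
  by rewrite big_split /= -!/(root_comb _) -e -e' subrr.
have := root_comb_eq0 h i; have := c0 i; have := c'0 i; move/eqP: ci; lia.
Qed.

Lemma root_coefs b : is_root A b -> exists j c,
  [/\ b = root_comb c, pairing b c = 2 * (half_norm A j)%:Z &
      forall i, ((half_norm A j)%:Z %| (half_norm A i)%:Z * c i)%Z].
Proof.
move=> [w [j ->]]; exists j.
have [c [e hp hd]] := weyl_act_comb w (fun k => (k == j)%:R).
rewrite root_comb_delta in e; exists c; split=> //; last first.
  move=> i; apply: hd => k; have [->|_] := eqVneq k j; first by rewrite mulr1.
  by rewrite mulr0 dvdz0.
rewrite hp /pairing (bigD1 j) //= eqxx mxE cartan_diag big1; first by rewrite mulr1 addr0 mulrC.
by move=> i /negPf->; rewrite mulr0 mul0r.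
Qed.

Lemma cartan_form_gt0 c i : c i != 0 ->
  0 < \sum_i \sum_j (half_norm A i)%:Z * A i j * c i * c j.
Proof.
move=> ci; have v0 : \row_k c k != 0.
  by apply: contraNneq ci => /rowP /(_ i); rewrite !mxE => ->.
have := cartan_posdef A v0; under eq_bigr => k _.
  by under eq_bigr => l _ do rewrite !mxE; over.
by [].
Qed.

Lemma pairing_comb c : pairing (root_comb c) c =
  \sum_i \sum_j (half_norm A i)%:Z * A i j * c i * c j.
Proof.
apply: eq_bigr => i _; rewrite root_combE mulr_sumr.
by apply: eq_bigr => j _; ring.
Qed.

(** Source of the factor 2 in [root_pos_neg]. *)
Lemma sum_symmetric (f : 'I_n -> 'I_n -> int) : (forall i k, f i k = f k i) ->
  \sum_i \sum_k f i k = \sum_i f i i + 2 * \sum_(i < n) \sum_(k < n | (k < i)%N) f i k.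
Proof.
move=> f_sym; pose g (i : 'I_n) := \sum_(k < n | (k < i)%N) f i k.
have row i : \sum_k f i k = f i i + (g i + \sum_(k < n | (i < k)%N) f i k).
  rewrite (bigD1 i) //=; congr (_ + _); rewrite (bigID (fun k : 'I_n => (k < i)%N)) /=.
  congr (_ + _); apply: eq_bigl => k; rewrite -val_eqE /=; first by case: ltngtP.
  by case: ltngtP.
under eq_bigr => i _ do rewrite row.
rewrite !big_split /= mulr_natl mulr2n; congr (_ + (_ + _)).
rewrite (exchange_big_dep predT) //=; apply: eq_bigr => i _.
by apply: eq_bigr => k _.
Qed.

(** Let [b = p - q] with [p] and [q] nonnegative of disjoint supports. The
    cross term of the norm is nonnegative, and by the divisibility in
    [root_coefs] the norms of [p] and [q] are multiples of [(b | b)]. If both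
    were nonzero, [b] would have at least twice its own norm. *)
Lemma root_pos_neg b : is_root A b -> positive b \/ positive (- b).
Proof.
move=> /root_coefs[j [c [-> + dvd_c]]]; rewrite pairing_comb => norm_c.
pose p i := Num.max (c i) 0; pose q i := Num.max (- c i) 0.
have cE i : c i = p i - q i by rewrite /p /q; lia.
have p_ge0 i : 0 <= p i by rewrite /p; lia.
have q_ge0 i : 0 <= q i by rewrite /q; lia.
have pq0 i : p i * q i = 0 by rewrite /p /q; nia.
pose Q (u v : 'I_n -> int) := \sum_i \sum_j (half_norm A i)%:Z * A i j * u i * v j.
have Q_c : Q c c = Q p p + Q q q - (Q p q + Q q p).
  rewrite /Q -!big_split -sumrB; apply: eq_bigr => i _.
  rewrite -!big_split -sumrB; apply: eq_bigr => k _.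
  by rewrite (cE i) (cE k) /=; ring.
have Q_le0 u v : (forall i, 0 <= u i) -> (forall i, 0 <= v i) ->
    (forall i, u i * v i = 0) -> Q u v <= 0.
  move=> u0 v0 uv; apply: sumr_le0 => i _; apply: sumr_le0 => k _.
  have [<-|ik] := eqVneq i k; first by rewrite -mulrA uv mulr0.
  rewrite -!mulrA; apply: mulr_ge0_le0 => //.
  by apply: mulr_le0_ge0; [exact: cartan_offdiag | exact: mulr_ge0].
(* Off the diagonal the terms of the norm come in equal pairs. *)
have Q_dvd u : (forall i, ((half_norm A j)%:Z %| (half_norm A i)%:Z * u i)%Z) ->
    (2 * (half_norm A j)%:Z %| Q u u)%Z.
  move=> du; rewrite {1}/Q sum_symmetric.
    rewrite mulr_sumr; apply: rpredD; apply: rpred_sum => i _.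
      rewrite cartan_diag mulrAC [_ * 2]mulrC -!mulrA dvdz_mul2l //=.
      by rewrite mulrA; apply/dvdz_mulr/du.
    rewrite dvdz_mul2l //=; apply: rpred_sum => k _.
    by rewrite -mulrA mulrAC mulrA; do 2!apply: dvdz_mulr; apply: du.
  by move=> i k; rewrite cartan_sym; ring.
have dj := half_norm_gt0 A j.
have dvd_p i : ((half_norm A j)%:Z %| (half_norm A i)%:Z * p i)%Z.
  by rewrite /p; case: (leP (c i) 0) => _; rewrite ?mulr0 ?dvdz0.
have dvd_q i : ((half_norm A j)%:Z %| (half_norm A i)%:Z * q i)%Z.
  by rewrite /q; case: (leP (- c i) 0) => _; rewrite ?mulr0 ?dvdz0 ?mulrN ?rpredN.
have Q_ge u : (forall i, ((half_norm A j)%:Z %| (half_norm A i)%:Z * u i)%Z) ->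
    (exists i, u i != 0) -> 2 * (half_norm A j)%:Z <= Q u u.
  move=> du [i ui]; have /dvdzP[k ek] := Q_dvd u du.
  have := cartan_form_gt0 ui; rewrite -/(Q u u) ek => k0.
  have k1 : 0 < k by move: k0; rewrite pmulr_lgt0 //; move: dj; clear; lia.
  by rewrite ler_peMl //; move: dj k1; clear; lia.
have [p0|[i pi]] : (forall i, p i = 0) \/ exists i, p i != 0.
  have [/forallP h|/forallPn[i hi]] := boolP [forall i, p i == 0].
    by left=> i; apply/eqP.
  by right; exists i.
- right; exists q; split=> //.
    rewrite /root_comb -sumrN; apply: eq_bigr => i _.
    by rewrite cE p0 sub0r scaleNr opprK.
  have [/forallP h|/forallPn[i hi]] := boolP [forall i, q i == 0]; last by exists i.
  exfalso; move: norm_c; rewrite big1; first by move: dj; clear; lia.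
  move=> i _; rewrite big1 // => k _.
  by rewrite (cE i) p0 (eqP (h i)) subrr mulr0 mul0r.
- left; exists p; split=> //; last by exists i.
  have q0 k : q k = 0.
    apply/eqP; apply: contraT => qk; exfalso.
    have hp : 2 * (half_norm A j)%:Z <= Q p p by apply: Q_ge => //; exists i.
    have hq : 2 * (half_norm A j)%:Z <= Q q q by apply: Q_ge => //; exists k.
    have h1 := Q_le0 p q p_ge0 q_ge0 pq0.
    have h2 : Q q p <= 0 by apply: Q_le0 => // l; rewrite mulrC.
    have hc : Q c c = 2 * (half_norm A j)%:Z by [].
    move: Q_c hp hq h1 h2 dj; rewrite hc; clear.
    move: (Q p p) (Q q q) (Q p q) (Q q p) (half_norm A j) => a1 a2 a3 a4 a5; lia.
  by apply: eq_bigr => l _; rewrite cE q0 subr0.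
Qed.

Lemma is_root_refl i b : is_root A b -> is_root A (simple_refl A i b).
Proof. by move=> [w [j ->]]; exists (i :: w), j. Qed.

Lemma is_root_simple i : is_root A (simple_root A i).
Proof. by exists [::], i. Qed.

(** The reflection [s_i] changes only the coordinate at [alpha_i], so a positive
    root made negative is a multiple of [alpha_i]; comparing norms and using the
    divisibility in [root_coefs], the multiple is 1. *)
Lemma simple_refl_positive i b : is_root A b -> positive b ->
  ~ positive (simple_refl A i b) -> b = simple_root A i.
Proof.
move=> rb [c [eb c_ge0 [k0 ck0]]] npos.
have [//|[c' [e' c'_ge0 _]]] := root_pos_neg (is_root_refl i rb).
have c_sum k : c k + c' k = b 0 i * (k == i)%:R.
  apply: (@root_comb_inj (fun k => c k + c' k) (fun k => b 0 i * (k == i)%:R)).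
  transitivity (root_comb c + root_comb c').
    by rewrite /root_comb -big_split; apply: eq_bigr => l _; rewrite scalerDl.
  rewrite -e' -eb /simple_refl opprB addrCA subrr addr0 -root_comb_delta.
  by rewrite /root_comb scaler_sumr; apply: eq_bigr => l _; rewrite scalerA.
have c0 k : k != i -> c k = 0.
  move=> /negPf ki; have := c_sum k; rewrite ki mulr0.
  by move: (c_ge0 k) (c'_ge0 k); clear; lia.
have ci : 0 < c i.
  rewrite lt_neqAle c_ge0 andbT eq_sym; have [<-//|k0i] := eqVneq k0 i.
  by rewrite c0 ?eqxx in ck0.
have eb' : b = c i *: simple_root A i.
  rewrite eb /root_comb (bigD1 i) //= big1 ?addr0 // => k ki.
  by rewrite c0 // scale0r.
have [j [d [ed nd dvd_d]]] := root_coefs rb.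
have dc : d =1 c by apply: root_comb_inj; rewrite -ed.
have norm : (half_norm A j)%:Z = (half_norm A i)%:Z * c i ^+ 2.
  apply: (@mulfI _ 2) => //; rewrite -nd /pairing (bigD1 i) //= big1 ?addr0.
    rewrite dc {1}eb' !mxE cartan_diag; ring.
  by move=> k ki; rewrite dc c0 // mulr0 mul0r.
have : ((half_norm A i)%:Z * c i ^+ 2 %| (half_norm A i)%:Z * c i)%Z.
  by rewrite -norm -dc.
have di := half_norm_gt0 A i.
rewrite dvdz_mul2l; last by move: di; clear; lia.
rewrite expr2 -[X in (_ %| X)%Z]mulr1 dvdz_mul2l ?gt_eqF // dvdz1 => /eqP q1.
have c1 : c i = 1 by move: (c i) ci q1 => x; clear; lia.
by rewrite eb' c1 scale1r.
Qed.

Lemma weyl_act_cat u v mu : weyl_act A (u ++ v) mu = weyl_act A u (weyl_act A v mu).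
Proof. by rewrite /weyl_act foldr_cat. Qed.

Lemma is_root_weyl w b : is_root A b -> is_root A (weyl_act A w b).
Proof. by elim: w => //= i w IH /IH; exact: is_root_refl. Qed.

Lemma weyl_act_inj w : injective (weyl_act A w).
Proof. by elim: w => //= i w IH mu nu /(inv_inj (simple_reflK A i)) /IH. Qed.

Lemma weyl_actB w mu nu : weyl_act A w (mu - nu) = weyl_act A w mu - weyl_act A w nu.
Proof.
elim: w => //= i w ->; apply/rowP => k; rewrite /simple_refl !mxE; ring.
Qed.

Lemma weyl_actZ w (a : int) mu : weyl_act A w (a *: mu) = a *: weyl_act A w mu.
Proof.
by elim: w => //= i w ->; rewrite /simple_refl !mxE scalerBr scalerA.
Qed.

(** The conjugation formula [u s_i u^-1 = s_(u alpha_i)] when [u alpha_i] is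
    simple. *)
Lemma simple_refl_conj u i j mu :
  weyl_act A u (simple_root A i) = simple_root A j ->
  weyl_act A u (simple_refl A i mu) = simple_refl A j (weyl_act A u mu).
Proof.
move=> uij; rewrite /simple_refl weyl_actB weyl_actZ uij; congr (_ - _ *: _).
have [c [e hp _]] := weyl_act_comb u (fun k => (k == i)%:R).
rewrite root_comb_delta uij in e.
have ec : c =1 (fun k => (k == j)%:R).
  by apply: root_comb_inj; rewrite root_comb_delta.
have hp' nu : (half_norm A j)%:Z * (weyl_act A u nu) 0 j = (half_norm A i)%:Z * nu 0 i.
  have := hp nu; rewrite /pairing (bigD1 j) //= ec eqxx mulr1 big1; last first.
    by move=> k /negPf kj; rewrite ec kj mulr0 mul0r.
  rewrite addr0 => ->; rewrite (bigD1 i) //= eqxx mulr1 big1 ?addr0 // => k /negPf->.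
  by rewrite mulr0 mul0r.
have := hp' mu; have := hp' (simple_root A i).
rewrite uij !mxE !cartan_diag => h1.
have di := half_norm_gt0 A i; have -> : (half_norm A j)%:Z = (half_norm A i)%:Z.
  by move: h1; clear; lia.
by move/mulfI => -> //; move: di; clear; lia.
Qed.

(** Reading the word from the right, the first letter [j] that makes the root
    negative meets it at [alpha_j]; by [simple_refl_conj] this letter cancels
    against the final [i]. *)
Lemma deletion u i : ~ positive (weyl_act A u (simple_root A i)) ->
  exists2 u', (size u' < size u)%N & weyl_act A (u ++ [:: i]) =1 weyl_act A u'.
Proof.
elim: u => [|j u IH] /= npos; first by case: npos; exact: positive_simple.
have [pos|npos'] := pselect (positive (weyl_act A u (simple_root A i))).
  have uij := simple_refl_positive (is_root_weyl u (is_root_simple i)) pos npos.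
  exists u => // mu.
  change (simple_refl A j (weyl_act A (u ++ [:: i]) mu) = weyl_act A u mu).
  rewrite weyl_act_cat /= (simple_refl_conj _ uij).
  exact: simple_reflK.
have [u' su' hu'] := IH npos'.
by exists (j :: u') => // mu; rewrite /= hu'.
Qed.

Lemma reduced_positive u i v : reduced_word A (u ++ i :: v) ->
  positive (weyl_act A u (simple_root A i)).
Proof.
move=> red; apply: contrapT => /deletion[u' su' hu'].
have lt_size : (size (u' ++ v) < size (u ++ i :: v))%N.
  by rewrite !size_cat /= addnS ltnS leq_add2r ltnW.
suff eq_act : weyl_act A (u' ++ v) =1 weyl_act A (u ++ i :: v).
  by have := red _ eq_act; rewrite leqNgt lt_size.
by move=> mu; rewrite !weyl_act_cat -hu' weyl_act_cat.
Qed.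

Lemma reduced_suffix u v : reduced_word A (u ++ v) -> reduced_word A v.
Proof.
move=> red v' ev; have eq_act : weyl_act A (u ++ v') =1 weyl_act A (u ++ v).
  by move=> mu; rewrite !weyl_act_cat ev.
by have := red _ eq_act; rewrite !size_cat leq_add2l.
Qed.

Lemma size_word_roots w : size (word_roots A w) = size w.
Proof. by elim: w => //= i w IH; rewrite size_map IH. Qed.

Lemma nth_word_roots u i v :
  nth 0 (word_roots A (u ++ i :: v)) (size u) = weyl_act A u (simple_root A i).
Proof.
elim: u => //= j u IH; rewrite (nth_map 0) ?IH //.
by rewrite size_word_roots size_cat /= addnS ltnS leq_addr.
Qed.

Lemma split_word (w : seq 'I_n) k : (k < size w)%N ->
  exists u i v, w = u ++ i :: v /\ size u = k.
Proof.
move=> kw; case: w kw => // i0 w kw.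
exists (take k (i0 :: w)), (nth i0 (i0 :: w) k), (drop k.+1 (i0 :: w)).
by rewrite -drop_nth // cat_take_drop size_takel // ltnW.
Qed.

Lemma word_root_positive w k : reduced_word A w -> (k < size w)%N ->
  positive (nth 0 (word_roots A w) k).
Proof.
move=> red /split_word[u [i [v [ew <-]]]]; rewrite ew nth_word_roots.
by apply: (@reduced_positive u i v); rewrite -ew.
Qed.

Lemma word_root_is_root w k : (k < size w)%N -> is_root A (nth 0 (word_roots A w) k).
Proof.
move=> /split_word[u [i [v [-> <-]]]]; rewrite nth_word_roots.
exact/is_root_weyl/is_root_simple.
Qed.

Lemma is_rootN b : is_root A b -> is_root A (- b).
Proof.
move=> [w [i ->]]; exists (w ++ [:: i]), i; rewrite weyl_act_cat /=.
by rewrite simple_refl_self -[- simple_root A i]scaleN1r weyl_actZ scaleN1r.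
Qed.

(** A repetition would give, for a factor [u'] of the word followed by [i'], the
    equality [u' alpha_i' = - alpha_i], although that root is positive. *)
Lemma word_roots_neq w j k : reduced_word A w -> (j < k)%N -> (k < size w)%N ->
  nth 0 (word_roots A w) j <> nth 0 (word_roots A w) k.
Proof.
move=> red jk kw.
have [u [i [v [ew su]]]] := split_word (ltn_trans jk kw).
have kv : (k - j.+1 < size v)%N by move: kw; rewrite ew size_cat su /=; lia.
have [u' [i' [v' [ev su']]]] := split_word kv.
have -> : nth 0 (word_roots A w) j = weyl_act A u (simple_root A i).
  by rewrite ew -su nth_word_roots.
have -> : nth 0 (word_roots A w) k = weyl_act A (u ++ i :: u') (simple_root A i').
  rewrite ew ev (_ : u ++ _ = (u ++ i :: u') ++ i' :: v'); last by rewrite -catA.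
  rewrite -(nth_word_roots _ _ v') size_cat /= su su'; congr nth; lia.
rewrite weyl_act_cat => /weyl_act_inj /= e.
have pos : positive (weyl_act A u' (simple_root A i')).
  by apply: (@reduced_positive _ _ v'); apply: (@reduced_suffix (u ++ [:: i])); rewrite -catA /= -ev -ew.
apply: (positive_opp pos); rewrite -[weyl_act A u' _](simple_reflK A i) -e.
by rewrite simple_refl_self opprK; exact: positive_simple.
Qed.
End Roots.

(** * Matrices graded by height *)

Section Filtration.
Variables (C : fieldType) (N : nat) (h : 'I_N -> int).
Implicit Types (X Y U : 'M[C]_N).

(** The basis vector of index [k] has height [h k]; these are the matrices that
    raise the height by at least [s]. *)
Definition deg_ge (s : int) X :=
  [forall k, forall l, (X k l != 0) ==> (h l + s <= h k)].

Lemma deg_geP s X :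
  reflect (forall k l, X k l != 0 -> h l + s <= h k) (deg_ge s X).
Proof.
apply: (iffP forallP) => [hX k l|hX k]; last by apply/forallP => l; exact/implyP/hX.
by move/forallP: (hX k) => /(_ l)/implyP.
Qed.

Lemma deg_ge0 s : deg_ge s 0.
Proof. by apply/deg_geP => k l; rewrite mxE eqxx. Qed.

Lemma deg_geD s X Y : deg_ge s X -> deg_ge s Y -> deg_ge s (X + Y).
Proof.
move=> /deg_geP hX /deg_geP hY; apply/deg_geP => k l; rewrite mxE => XY.
have [X0|/hX//] := eqVneq (X k l) 0.
by apply: hY; rewrite X0 add0r in XY.
Qed.

Lemma deg_geZ s a X : deg_ge s X -> deg_ge s (a *: X).
Proof.
move=> /deg_geP hX; apply/deg_geP => k l.
by rewrite mxE mulf_eq0 negb_or => /andP[_ /hX].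
Qed.

Lemma deg_ge_sum s (I : Type) (r : seq I) (F : I -> 'M[C]_N) :
  (forall i, deg_ge s (F i)) -> deg_ge s (\sum_(i <- r) F i).
Proof. by move=> hF; elim/big_rec: _ => [|i X _ hX]; [exact: deg_ge0 | exact: deg_geD]. Qed.

Lemma deg_geW s t X : s <= t -> deg_ge t X -> deg_ge s X.
Proof.
move=> st /deg_geP hX; apply/deg_geP => k l /hX.
by apply: le_trans; rewrite lerD2l.
Qed.

Lemma deg_geM s t X Y : deg_ge s X -> deg_ge t Y -> deg_ge (s + t) (X * Y).
Proof.
move=> /deg_geP hX /deg_geP hY; apply/deg_geP => k l; rewrite mxE => XY.
have [j /andP[Xj Yj]] : exists j, (X k j != 0) && (Y j l != 0).
  apply/existsP; apply: contraR XY => /existsPn nj; apply/eqP/big1 => j _.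
  by have := nj j; rewrite negb_and !negbK => /orP[]/eqP->; rewrite ?mul0r ?mulr0.
by have := hX _ _ Xj; have := hY _ _ Yj; clear; lia.
Qed.

Lemma deg_ge1 : deg_ge 0 1.
Proof.
by apply/deg_geP => k l; rewrite mxE; have [->|] := eqVneq k l; rewrite ?addr0 // eqxx.
Qed.

Lemma deg_geX s X k : deg_ge s X -> deg_ge (s *+ k) (X ^+ k).
Proof.
move=> hX; elim: k => [|k IH]; first by rewrite mulr0n expr0; exact: deg_ge1.
by rewrite mulrS exprS; exact: deg_geM.
Qed.

(** When [N <= 1] the truncated exponential has no linear term. *)
Lemma nilp_exp_expansion s X : (1 < N)%N -> 0 < s -> deg_ge s X ->
  deg_ge (s *+ 2) (nilp_exp X - 1 - X).
Proof.
move=> N1 s0 hX; rewrite /nilp_exp.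
rewrite -(big_mkord xpredT (fun k => (k`!%:R)^-1 *: X ^+ k)).
rewrite big_ltn 1?ltnW // big_ltn // !invr1 !scale1r expr0 expr1.
rewrite [1 + _]addrC addrK addrAC subrr add0r big_seq.
elim/big_rec: _ => [|k Y]; first exact: deg_ge0.
rewrite mem_index_iota => /andP[k2 _] hY; apply: deg_geD => //; apply: deg_geZ.
by apply: (deg_geW _ (deg_geX _ hX)); apply: ler_wpMn2l => //; exact: ltW.
Qed.

(** To first order a product of elements [1 + Y_i + ...] is [1 + sum_i Y_i],
    although the factors do not commute. *)
Lemma prod_expansion s (I : Type) (r : seq I) (E Y : I -> 'M[C]_N) : 0 < s ->
  (forall i, deg_ge s (Y i)) -> (forall i, deg_ge (s *+ 2) (E i - 1 - Y i)) ->
  deg_ge (s *+ 2) (\prod_(i <- r) E i - 1 - \sum_(i <- r) Y i).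
Proof.
move=> s0 hY hE.
have le2 : s <= s *+ 2 by rewrite mulr2n lerDr ltW.
have hsum := fun r' : seq I => deg_ge_sum r' hY.
elim: r => [|i r IH]; first by rewrite !big_nil subrr subr0; exact: deg_ge0.
rewrite !big_cons; set P := \prod_(j <- r) E j in IH *.
set S := \sum_(j <- r) Y j in IH *.
have hP1 : deg_ge s (P - 1).
  by rewrite -[P - 1](subrK S); apply: deg_geD (hsum r); exact: (deg_geW _ IH).
have hP : deg_ge 0 P.
  rewrite -[P](subrK 1); apply: deg_geD deg_ge1.
  by apply: (deg_geW _ hP1); exact: ltW.
have -> : E i * P - 1 - (Y i + S) =
    (E i - 1 - Y i) * P + Y i * (P - 1) + (P - 1 - S).
  rewrite !mulrBl mul1r mulrBr mulr1.
  rewrite [_ - Y i * P + _]addrA subrK addrAC [_ - P - Y i + _]addrA.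
  by rewrite [_ - P - Y i]addrAC [_ - Y i - P + _]addrA subrK opprD addrA addrAC.
apply: deg_geD => //; apply: deg_geD.
  by rewrite -[s *+ 2]addr0; exact: deg_geM.
by rewrite mulr2n; exact: deg_geM.
Qed.

Lemma prod_unipotent s (I : Type) (r : seq I) (X : I -> 'M[C]_N) :
  (1 < N)%N -> 0 < s -> (forall i, deg_ge s (X i)) ->
  deg_ge s (\prod_(i <- r) nilp_exp (X i) - 1).
Proof.
move=> N1 s0 hX.
have hE i : deg_ge (s *+ 2) (nilp_exp (X i) - 1 - X i) by exact: nilp_exp_expansion.
rewrite -[_ - 1](subrK (\sum_(i <- r) X i)); apply: deg_geD; last exact: deg_ge_sum.
apply: (deg_geW _ (prod_expansion r s0 hX hE)).
by rewrite mulr2n lerDr ltW.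
Qed.

(** Among the nonzero coordinates of a row vector killed by [U], none can have
    maximal height. *)
Lemma unipotent_unitmx U : deg_ge 1 (U - 1) -> U \in unitmx.
Proof.
move=> /deg_geP hU; rewrite -row_free_unit; apply: inj_row_free => v vU.
apply/rowP => k0; rewrite [RHS]mxE; apply: contraTeq isT => vk0.
(* Minimising [- h] selects a nonzero coordinate of maximal height. *)
case: (@arg_minP _ _ _ k0 (fun k => v 0 k != 0) (fun k => - h k) vk0) => k vk hk.
have /rowP/(_ k) := vU; rewrite !mxE (bigD1 k) //= big1 ?addr0.
  have -> : U k k = 1.
    have := hU k k; rewrite !mxE eqxx subr_eq0 => hUk.
    by apply/eqP; apply: contraT => /hUk; clear; lia.
  by rewrite mulr1 => /eqP; rewrite (negPf vk).
move=> l lk; have [->|vl] := eqVneq (v 0 l) 0; first by rewrite mul0r.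
have := hU l k; rewrite !mxE (negPf lk) subr0.
have [->|_] := eqVneq (U l k) 0; first by rewrite mulr0.
by have := hk l vl; clear; lia.
Qed.
End Filtration.

Section Triangular.
Variables (C : fieldType) (N : nat) (h : 'I_N -> int).

(** The uniqueness of the decomposition of an element of [U^- T U], read degree
    by degree: the part of degree 0 of [u z = t v] gives [z = t], and then [u]
    and [v] agree up to scalars off the diagonal, where one lowers the height and
    the other raises it. *)
Lemma triangular_unique (u v z : 'M[C]_N) (t : 'I_N -> C) :
  (forall k, t k != 0) ->
  deg_ge (fun k => - h k) 1 (u - 1) -> deg_ge h 1 (v - 1) ->
  (forall k l, z k l != 0 -> h k = h l) ->
  u *m z = diag_mx (\row_k t k) *m v ->
  [/\ z = diag_mx (\row_k t k), u = 1 & v = 1].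
Proof.
move=> t0 /deg_geP hu /deg_geP hv hz /matrixP uz.
have u_le k l : k != l -> u k l != 0 -> h k < h l.
  by move=> /negPf kl ukl; have := hu k l; rewrite !mxE kl subr0 => /(_ ukl); clear; lia.
have v_le k l : k != l -> v k l != 0 -> h l < h k.
  by move=> /negPf kl vkl; have := hv k l; rewrite !mxE kl subr0 => /(_ vkl); clear; lia.
have u1 k : u k k = 1.
  have := hu k k; rewrite !mxE eqxx subr_eq0 => hk.
  by apply/eqP; apply: contraT => /hk; clear; lia.
have v1 k : v k k = 1.
  have := hv k k; rewrite !mxE eqxx subr_eq0 => hk.
  by apply/eqP; apply: contraT => /hk; clear; lia.
have tv k l : (diag_mx (\row_k t k) *m v) k l = t k * v k l.
  by rewrite mul_diag_mx !mxE.
have zE : z = diag_mx (\row_k t k).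
  apply/matrixP => k l; have [hkl|hkl] := eqVneq (h k) (h l); last first.
    rewrite !mxE; have [e|_] := eqVneq k l; first by rewrite e eqxx in hkl.
    by apply/eqP; apply: contraT => /hz e; rewrite e eqxx in hkl.
  have := uz k l; rewrite tv mxE (bigD1 k) //= u1 mul1r big1 ?addr0 => [->|j jk].
    rewrite !mxE; have [<-|kl] := eqVneq k l; first by rewrite v1 mulr1.
    have [->|/(v_le _ _ kl)] := eqVneq (v k l) 0; first by rewrite mulr0.
    by rewrite hkl ltxx.
  have [->|/hz zjl] := eqVneq (z j l) 0; first by rewrite mulr0.
  have [->|] := eqVneq (u k j) 0; first by rewrite mul0r.
  by rewrite eq_sym in jk; move/(u_le _ _ jk); rewrite zjl hkl ltxx.
have ut k l : u k l * t l = t k * v k l.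
  by rewrite -tv -uz zE mul_mx_diag !mxE.
split=> //; apply/matrixP => k l; rewrite [RHS]mxE; have [<-//|kl] := eqVneq k l.
  apply/eqP; apply: contraT => ukl; have vkl : v k l != 0.
    apply: contraNneq ukl => v0; have /eqP := ut k l.
    by rewrite v0 mulr0 mulf_eq0 (negPf (t0 l)) orbF.
  by have := u_le _ _ kl ukl; have := v_le _ _ kl vkl; clear; lia.
apply/eqP; apply: contraT => vkl; have ukl : u k l != 0.
  apply: contraNneq vkl => u0; have /eqP := ut k l.
  by rewrite u0 mul0r eq_sym mulf_eq0 (negPf (t0 k)).
by have := u_le _ _ kl ukl; have := v_le _ _ kl vkl; clear; lia.
Qed.
End Triangular.

(** * Central elements of a Chevalley group *)

Section Exponentials.
Variables (C : numFieldType) (N : nat).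
Implicit Types (X z : 'M[C]_N).

Lemma comm_mx_small X Y : (N <= 1)%N -> X *m Y = Y *m X :> 'M[C]_N.
Proof.
case: N X Y => [|[|//]] X Y _; apply/matrixP => i j; first by case: i.
by rewrite !mxE !big_ord1 !ord1 mulrC.
Qed.

Lemma exp_scalemx (a : C) X j : (a *: X) ^+ j = a ^+ j *: X ^+ j.
Proof.
elim: j => [|j IH]; first by rewrite !expr0 scale1r.
by rewrite !exprS IH -[LHS]scalemxAl -[X in _ *: X]scalemxAr scalerA.
Qed.

(** The commutator of [z] with [exp (a X)] is a polynomial in [a] vanishing at
    infinitely many points; its linear coefficient is the commutator of [z] and
    [X]. *)
Lemma comm_one_parameter z X :
  (forall a : C, z * nilp_exp (a *: X) = nilp_exp (a *: X) * z) ->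
  z *m X = X *m z.
Proof.
move=> hz; have [N1|N1] := leqP N 1; first exact: comm_mx_small.
apply/matrixP => k l; apply/eqP; rewrite -subr_eq0; apply/eqP.
pose p := \poly_(j < N) ((j`!%:R)^-1 * ((z * X ^+ j) k l - (X ^+ j * z) k l)).
suff p0 : p = 0.
  by have := coef_poly N (fun j => (j`!%:R)^-1 * ((z * X ^+ j) k l - (X ^+ j * z) k l)) 1;
    rewrite -/p p0 coef0 N1 invr1 mul1r expr1.
have zL c (Y : 'M[C]_N) : (z * (c *: Y)) k l = c * (z * Y) k l.
  by rewrite -[z * (c *: Y)]/(z *m (c *: Y)) -scalemxAr mxE.
have zR c (Y : 'M[C]_N) : ((c *: Y) * z) k l = c * (Y * z) k l.
  by rewrite -[(c *: Y) * z]/((c *: Y) *m z) -scalemxAl mxE.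
have p_nat (i : nat) : root p i%:R.
  have := hz i%:R; rewrite /nilp_exp mulr_sumr mulr_suml => /matrixP/(_ k l).
  rewrite !summxE => /eqP; rewrite -subr_eq0 -sumrB => /eqP e.
  apply/rootP; rewrite horner_poly -[RHS]e; apply: eq_bigr => j _.
  by rewrite exp_scalemx scalerA zL zR -mulrBr mulrAC.
apply: (@roots_geq_poly_eq0 _ p [seq i%:R | i <- iota 0 N]).
- by apply/allP => _ /mapP[i _ ->].
- rewrite map_inj_uniq ?iota_uniq // => i j /eqP; rewrite eqr_nat; exact: eqP.
- by rewrite size_map size_iota size_poly.
Qed.
End Exponentials.

Section Chevalley.
Variables (C : numFieldType) (n : nat) (A : simple_cartan n) (M : lattice A).
Variables (N : nat) (V : chevalley_rep C M N).

Let wt (k : 'I_N) : 'rV[int]_n := val (rep_weight V k).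

Lemma root_space_entry b X : root_space V b X ->
  forall k l, X k l != 0 -> wt k = wt l + b.
Proof.
move=> [_ hX] k l Xkl; apply/rowP => i.
have /matrixP/(_ k l) := hX i; rewrite /mx_bracket /coroot_mx.
rewrite mul_diag_mx mul_mx_diag !mxE [X k l * _]mulrC -mulrBl => /(mulIf Xkl).
by rewrite -rmorphB => /eqP; rewrite eqr_int subr_eq addrC => /eqP.
Qed.

Lemma exists_weight_neq0 i : exists k, wt k 0 i != 0.
Proof.
have [c /(congr1 val)/rowP/(_ i)] := rep_weight_span V (root_weight M i).
rewrite raddf_sum summxE /= mxE cartan_diag => e.
apply/existsP; apply: contra_eqT e => /existsPn wt0; rewrite big1 // => k _.
rewrite val_weightMz mxE -/(wt k); have := wt0 k; rewrite negbK => /eqP->.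
by rewrite mulr0.
Qed.

(** A representation of dimension at most 1 has zero brackets, hence only the
    zero weight, which does not span a lattice containing the roots. *)
Lemma rep_dim_gt1 : (1 < N)%N.
Proof.
rewrite ltnNge; apply/negP => N1; pose i := Ordinal (rank_gt0 A).
have [k /negP[]] := exists_weight_neq0 i.
have := rep_ef V i i; rewrite eqxx /mx_bracket (comm_mx_small _ _ N1) subrr.
by move=> /esym/matrixP/(_ k k); rewrite !mxE eqxx mulr1n => /eqP; rewrite intr_eq0.
Qed.

Lemma rep_e_neq0 i : rep_e V i != 0.
Proof.
apply/eqP => e0; have [k /negP[]] := exists_weight_neq0 i.
have := rep_ef V i i; rewrite eqxx /mx_bracket e0 mul0mx mulmx0 subrr.
by move=> /esym/matrixP/(_ k k); rewrite !mxE eqxx mulr1n => /eqP; rewrite intr_eq0.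
Qed.

Lemma rep_e_root_space i : root_space V (simple_root A i) (rep_e V i).
Proof.
split=> [|j]; first exact: lie_e.
by rewrite rep_he mxE.
Qed.

Lemma rep_f_root_space i : root_space V (- simple_root A i) (rep_f V i).
Proof.
split=> [|j]; first exact: lie_f.
by rewrite rep_hf !mxE rmorphN.
Qed.

Lemma root_spaceZ b X a : root_space V b X -> root_space V b (a *: X).
Proof.
move=> [lX hX]; split=> [|i]; first exact: lie_scale.
by rewrite scalerA mulrC -scalerA -hX /mx_bracket -scalemxAr -scalemxAl scalerBr.
Qed.

Lemma center_comm_root z b X : chevalley_center V z -> is_root A b ->
  root_space V b X -> z *m X = X *m z.
Proof.
move=> [_ hz] rb hX; apply: comm_one_parameter => a; apply: hz.
exact: chev_exp rb (root_spaceZ a hX).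
Qed.

(** Commuting with [e_i] and [f_i], a central element commutes with the coroot
    [[e_i, f_i]], whose eigenvalues separate the weights in characteristic 0. *)
Lemma center_preserves_weight z : chevalley_center V z ->
  forall k l, z k l != 0 -> wt k = wt l.
Proof.
move=> hz k l zkl; apply/rowP => i; apply/eqP.
have ze := center_comm_root hz (is_root_simple A i) (rep_e_root_space i).
have zf := center_comm_root hz (is_rootN (is_root_simple A i)) (rep_f_root_space i).
have := rep_ef V i i; rewrite eqxx => zh.
have /matrixP/(_ k l) : z *m coroot_mx C (rep_weight V) i = coroot_mx C (rep_weight V) i *m z.
  rewrite -zh /mx_bracket mulmxBr mulmxBl !mulmxA ze zf -!mulmxA.
  by rewrite ze zf.
rewrite /coroot_mx mul_diag_mx mul_mx_diag !mxE mulrC => /(mulIf zkl) /eqP.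
by rewrite eqr_int eq_sym.
Qed.

(** Take [k] with [c k <> 0] and [b k] of minimal height. In the degree of that
    height only the linear terms contribute, and distinct weights prevent a
    cancellation. *)
Lemma prod_exp_eq1 (ht : 'rV[int]_n -> int) m (b : 'I_m -> 'rV[int]_n)
    (Y : 'I_m -> 'M[C]_N) (c : 'I_m -> C) :
  (forall mu nu, ht (mu + nu) = ht mu + ht nu) ->
  (forall k, 0 < ht (b k)) -> injective b ->
  (forall k, root_space V (b k) (Y k)) -> (forall k, Y k != 0) ->
  \prod_(k < m) nilp_exp (c k *: Y k) = 1 -> forall k, c k = 0.
Proof.
move=> htD ht_gt0 b_inj hY Y0 prod1 k0; apply/eqP; apply: contraT => ck0.
case: (@arg_minP _ _ _ k0 (fun k => c k != 0) (fun k => ht (b k)) ck0) => k ck k_min.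
pose h j := ht (wt j); pose s := ht (b k).
have degY l : deg_ge h s (c l *: Y l).
  apply/deg_geP => i j; rewrite mxE mulf_eq0 negb_or => /andP[cl Yl].
  by rewrite /h (root_space_entry (hY l) Yl) htD lerD2l; apply: k_min.
have [i [j Yij]] : exists i j, Y k i j != 0.
  have : [exists i, [exists j, Y k i j != 0]].
    apply: contraR (Y0 k) => /existsPn nY; apply/eqP/matrixP => i j.
    by rewrite mxE; have /existsPn/(_ j) := nY i; rewrite negbK => /eqP.
  by case/existsP => i /existsP[j]; exists i, j.
have hE l : deg_ge h (s *+ 2) (nilp_exp (c l *: Y l) - 1 - c l *: Y l).
  exact: nilp_exp_expansion rep_dim_gt1 (ht_gt0 k) (degY l).
have /deg_geP/(_ i j) := prod_expansion (index_enum 'I_m) (ht_gt0 k) degY hE.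
rewrite prod1 subrr sub0r mxE oppr_eq0 summxE (bigD1 k) //= big1 ?addr0.
  rewrite mxE mulf_eq0 (negPf ck) (negPf Yij) => /(_ isT).
  rewrite /h (root_space_entry (hY k) Yij) htD lerD2l mulr2n -/s => h2.
  by have := ht_gt0 k; rewrite -/s; move: (s) h2; clear; lia.
move=> l lk; rewrite mxE; have [->|Yl] := eqVneq (Y l i j) 0; first by rewrite mulr0.
have := root_space_entry (hY k) Yij; rewrite (root_space_entry (hY l) Yl).
by move/addrI/b_inj => e; rewrite e eqxx in lk.
Qed.

Section PiCentral.
Variables (eps : C) (ell : nat) (w : seq 'I_n).
Variables (X : 'rV[int]_n -> 'M[C]_N) (eta : SpecZ0 M eps ell w).
Hypothesis red_w : reduced_word A w.
Hypothesis HX : root_vectors V X.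
Hypothesis central : chevalley_center V (pi_M V X eta).

Let t : weight M -> C := torus_part eta.

(** Heights turn [unip_neg] and [unip_pos] into lower and upper unipotent
    matrices, so that [triangular_unique] and [prod_exp_eq1] apply. *)
Lemma pi_central :
  [/\ pi_M V X eta = torus_mx V t ^+ 2,
      forall k, eta (Z0E M eps ell k) = 0,
      forall k, eta (Z0F M eps ell k) = 0 &
      forall i, t (root_weight M i) ^+ 2 = 1].
Proof.
have [x [D [D0 hx]]] := height_exists A.
pose ht (mu : 'rV[int]_n) := \sum_j x j * mu 0 j.
have htD mu nu : ht (mu + nu) = ht mu + ht nu.
  by rewrite /ht -big_split; apply: eq_bigr => j _; rewrite mxE mulrDr.
have htN mu : ht (- mu) = - ht mu.
  by rewrite /ht -sumrN; apply: eq_bigr => j _; rewrite mxE mulrN.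
have ht_root (k : 'I_(size w)) : 0 < ht (word_root A k).
  have [c [e c0 [i ci]]] : positive A (word_root A k) := word_root_positive red_w (ltn_ord k).
  rewrite e.
  have -> : ht (root_comb A c) = \sum_i c i * D.
    rewrite /ht; under eq_bigr => j _ do rewrite root_combE mulr_sumr.
    rewrite exchange_big; apply: eq_bigr => l _; rewrite -(hx l) mulr_sumr.
    by apply: eq_bigr => j _; rewrite mxE mulrCA.
  rewrite (bigD1 i) //= ltr_pwDl //.
    by rewrite mulr_gt0 // lt_neqAle eq_sym ci c0.
  by apply: sumr_ge0 => l _; rewrite mulr_ge0 // ltW.
have root_inj : injective (fun k : 'I_(size w) => word_root A k).
  move=> j k e; apply/val_inj/eqP; case: ltngtP => // jk.
    by case: (word_roots_neq red_w jk (ltn_ord k)).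
  by case: (word_roots_neq red_w jk (ltn_ord j)).
have rootX (k : 'I_(size w)) := HX (word_root_is_root A (ltn_ord k)).
have rootNX (k : 'I_(size w)) :=
  HX (is_rootN (word_root_is_root A (ltn_ord k))).
pose h j := ht (wt j).
have unip_gen (g : 'rV[int]_n -> int) (b : 'I_(size w) -> 'rV[int]_n)
    (Y : 'I_(size w) -> 'M[C]_N) (c : 'I_(size w) -> C) :
    (forall mu nu, g (mu + nu) = g mu + g nu) ->
    (forall k, 0 < g (b k)) -> (forall k, root_space V (b k) (Y k)) ->
    deg_ge (fun j => g (wt j)) 1 (\prod_k nilp_exp (c k *: Y k) - 1).
  move=> gD g0 hY; apply: prod_unipotent rep_dim_gt1 _ _ => // k.
  apply: deg_geZ; apply/deg_geP => i j /(root_space_entry (hY k)) ->.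
  by rewrite gD lerD2l; move: (g0 k); clear; lia.
have hu : deg_ge (fun k => - h k) 1 (unip_neg X eta - 1).
  apply: (unip_gen (fun mu => - ht mu) (fun k => - word_root A k)
    (fun k => X (- word_root A k)) (fun k => eta (Z0F M eps ell k))) => [mu nu|k|k].
  - by rewrite htD opprD.
  - by rewrite htN opprK.
  - by case: (rootNX k).
have hv : deg_ge h 1 (unip_pos X eta - 1).
  by apply: (unip_gen ht (fun k => word_root A k) (fun k => X (word_root A k))
    (fun k => eta (Z0E M eps ell k))) => // k; case: (rootX k).
have hz k l : pi_M V X eta k l != 0 -> h k = h l.
  by move=> /(center_preserves_weight central); rewrite /h => ->.
have u_unit := unipotent_unitmx hu.
have torus2 : torus_mx V t ^+ 2 = diag_mx (\row_k t (rep_weight V k) ^+ 2).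
  rewrite expr2 /torus_mx -[_ * _]/(diag_mx _ *m diag_mx _).
  by apply/matrixP => k l; rewrite mul_diag_mx !mxE mulrnAr expr2.
have tM : weight_character t := torus_part_character eta.
have t2_neq0 k : t (rep_weight V k) ^+ 2 != 0.
  by rewrite expf_neq0 // (char_neq0 tM).
have uz : unip_neg X eta *m pi_M V X eta =
    diag_mx (\row_k t (rep_weight V k) ^+ 2) *m unip_pos X eta.
  have -> : pi_M V X eta =
    invmx (unip_neg X eta) *m (torus_mx V t ^+ 2) *m unip_pos X eta by [].
  by rewrite -torus2 !mulmxA mulmxV // mul1mx.
have [zE u1 v1] := triangular_unique t2_neq0 hu hv hz uz.
split.
- by rewrite zE torus2.
- apply: (prod_exp_eq1 (Y := fun k => X (word_root A k)) htD ht_root root_inj _ _ v1) => k; by case: (rootX k).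
- apply: (prod_exp_eq1 (ht := fun mu => - ht mu) (b := fun k => - word_root A k)
    (Y := fun k => X (- word_root A k)) _ _ _ _ _ u1) => [mu nu|k|j k|k|k].
  + by rewrite htD opprD.
  + by rewrite htN opprK.
  + by move/oppr_inj/root_inj.
  + by case: (rootNX k).
  + by case: (rootNX k).
- move=> i; have := center_comm_root central (is_root_simple A i) (rep_e_root_space i).
  have [k [l ekl]] : exists k l, rep_e V i k l != 0.
    have : [exists k, [exists l, rep_e V i k l != 0]].
      apply: contraR (rep_e_neq0 i) => /existsPn nY; apply/eqP/matrixP => k l.
      by rewrite mxE; have /existsPn/(_ l) := nY k; rewrite negbK => /eqP.
    by case/existsP => k /existsP[l]; exists k, l.
  rewrite zE => /matrixP/(_ k l); rewrite mul_diag_mx mul_mx_diag !mxE.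
  have -> : rep_weight V k = rep_weight V l + root_weight M i.
    by apply: val_inj; apply: (root_space_entry (rep_e_root_space i) ekl).
  rewrite tM.2 exprMn mulrC => /(mulfI ekl) /eqP.
  by rewrite -subr_eq0 -[X in _ - X]mulr1 -mulrBr mulf_eq0 (negPf (t2_neq0 l)) subr_eq0 => /eqP.
Qed.
End PiCentral.
End Chevalley.

(** * Evaluation of free algebras and of their quotients *)

Section FreeAlgebraEval.
Variables (R : comNzRingType) (I : choiceType) (S : nzRingType).
Variables (f : {rmorphism R -> S}) (h : I -> S).
Hypothesis f_central : forall c x, f c * x = x * f c.

Definition word_eval (s : {fmonom I}) : S := \prod_(i <- s) h i.

Fact word_eval_mmorphism : mmorphism word_eval.
Proof.
split=> [s t|]; rewrite /word_eval ?fmM ?big_cat //.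
by rewrite fm1 big_nil.
Qed.

HB.instance Definition _ :=
  monalg.isMultiplicative.Build {fmonom I} S word_eval word_eval_mmorphism.

(** The universal property of the free algebra, for a target in which the scalars
    are central; the map [free_lift] is the instance where the target is the free
    algebra itself. *)
Definition free_eval : {malg R[{fmonom I}]} -> S := mmap f word_eval.

Fact free_eval_zmod : zmod_morphism free_eval.
Proof. exact: raddfB. Qed.

Fact free_eval_monoid : monoid_morphism free_eval.
Proof.
have [eM e1] := @commr_mmap_is_multiplicative _ _ _ f word_eval
  (fun g m m' => f_central (g@_m) _).
by split.
Qed.

Lemma free_evalZ c x : free_eval (c *: x) = f c * free_eval x.
Proof. exact: mmapZ. Qed.

Lemma free_eval_gen i : free_eval (free_gen R i) = h i.
Proof.
rewrite /free_eval (mmapU (f := f)) /word_eval fmU big_seq1 -[RHS]mul1r.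
by congr (_ * _); exact: rmorph1 f.
Qed.

Lemma free_eval_scal c : free_eval (scal c) = f c.
Proof. exact: mmapC. Qed.

Lemma free_evalM : {morph free_eval : x y / x * y}.
Proof. exact: free_eval_monoid.2. Qed.

Lemma free_eval1 : free_eval 1 = 1.
Proof. exact: free_eval_monoid.1. Qed.
End FreeAlgebraEval.

Section QuotientLift.
Variables (R : comNzRingType) (A B : assocAlgType R) (S : A -> Prop).
Variable phi : alg_hom A B.
Hypothesis phi_rel : forall x, S x -> phi x = 0.

Lemma two_sided_ideal_kernel x : two_sided_ideal S x -> phi x = 0.
Proof.
elim=> {x} [x|| x y _ hx _ hy | a x _ hx | a x _ hx]; first exact: phi_rel.
- exact: rmorph0.
- by rewrite rmorphD hx hy addr0.
- by rewrite rmorphM hx mulr0.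
- by rewrite rmorphM hx mul0r.
Qed.

Definition quot_lift (x : quot_alg S) : B := phi (quot_repr x).

Lemma quot_liftE x : quot_lift (quot_proj S x) = phi x.
Proof.
apply/eqP; rewrite /quot_lift -subr_eq0 -rmorphB; apply/eqP.
by apply: two_sided_ideal_kernel; apply/quot_projP; rewrite quot_reprK.
Qed.

Fact quot_lift_zmod : zmod_morphism quot_lift.
Proof.
move=> x y; rewrite -[x]quot_reprK -[y]quot_reprK.
by rewrite -rmorphB !quot_liftE rmorphB.
Qed.

Fact quot_lift_monoid : monoid_morphism quot_lift.
Proof.
split=> [|x y]; first by rewrite -(rmorph1 (quot_proj S)) quot_liftE rmorph1.
rewrite -[x]quot_reprK -[y]quot_reprK.
by rewrite -rmorphM !quot_liftE rmorphM.
Qed.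

HB.instance Definition _ :=
  GRing.isZmodMorphism.Build (quot_alg S) B quot_lift quot_lift_zmod.
HB.instance Definition _ :=
  GRing.isMonoidMorphism.Build (quot_alg S) B quot_lift quot_lift_monoid.

Fact quot_lift_scal c : quot_lift (scal c) = scal c.
Proof. by rewrite -(alg_fun_scal phi) -quot_liftE. Qed.

Definition quot_lift_hom : alg_hom (quot_alg S) B := AlgHom quot_lift_scal.
End QuotientLift.

Section FreeAlgebraCharacter.
Variables (R : comNzRingType) (I : choiceType) (h : I -> R).

Definition free_char : {malg R[{fmonom I}]} -> R^o := free_eval idfun h.

Fact free_char_zmod : zmod_morphism free_char.
Proof. exact: free_eval_zmod. Qed.

Fact free_char_monoid : monoid_morphism free_char.
Proof. by apply: free_eval_monoid => c x; exact: mulrC. Qed.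

HB.instance Definition _ :=
  GRing.isZmodMorphism.Build {malg R[{fmonom I}]} R^o free_char free_char_zmod.
HB.instance Definition _ :=
  GRing.isMonoidMorphism.Build {malg R[{fmonom I}]} R^o free_char
    free_char_monoid.

Fact free_char_scal c : free_char (scal c) = scal c.
Proof. exact: free_eval_scal. Qed.

Definition free_char_hom : alg_hom {malg R[{fmonom I}]} R^o :=
  AlgHom free_char_scal.

Lemma free_char_gen i : free_char_hom (free_gen R i) = h i.
Proof. exact: free_eval_gen. Qed.

Lemma free_charZ c x : free_char_hom (c *: x) = c * free_char_hom x :> R.
Proof. exact: free_evalZ. Qed.
End FreeAlgebraCharacter.

(** * The grading by the root lattice *)

Section Grading.
Variables (C : fieldType) (n : nat) (A : simple_cartan n) (M : lattice A).
Variable eps : C.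

(** Homogeneous elements for the grading of the free algebra by the root
    lattice, given by closure rules: the degree of an element is only used through
    inductions over these rules. *)
Inductive homog : 'rV[int]_n -> free_alg C M -> Prop :=
| homogE i : homog (simple_root A i) (Defs.freeE C M i)
| homogF i : homog (- simple_root A i) (freeF C M i)
| homogK mu : homog 0 (freeK C mu)
| homog0 b : homog b 0
| homog1 : homog 0 1
| homogD b x y : homog b x -> homog b y -> homog b (x + y)
| homogZ c b x : homog b x -> homog b (c *: x)
| homogM b1 b2 x y : homog b1 x -> homog b2 y -> homog (b1 + b2) (x * y).

Lemma homogN b x : homog b x -> homog b (- x).
Proof. by rewrite -scaleN1r; exact: homogZ. Qed.

Lemma homogX b x k : homog b x -> homog (b *+ k) (x ^+ k).
Proof.
move=> hx; elim: k => [|k IH]; first by rewrite expr0; exact: homog1.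
by rewrite exprS mulrS; exact: homogM.
Qed.

Lemma homog_sum (I : finType) b (F : I -> free_alg C M) :
  (forall i, homog b (F i)) -> homog b (\sum_i F i).
Proof. by move=> hF; elim/big_rec: _ => [|i x _ hx]; [exact: homog0|exact: homogD]. Qed.

Lemma lusztig_TM i : {morph @lusztig_T C n A M eps i : x y / x * y}.
Proof. by apply: free_evalM; exact: malgC_central. Qed.

Lemma lusztig_T1 i : @lusztig_T C n A M eps i 1 = 1.
Proof. by apply: free_eval1; exact: malgC_central. Qed.

Lemma lusztig_TD i : {morph @lusztig_T C n A M eps i : x y / x + y}.
Proof. by move=> x y; exact: mmapD. Qed.

Lemma lusztig_T0 i : @lusztig_T C n A M eps i 0 = 0.
Proof. exact: mmap0. Qed.

Lemma lusztig_TZ i c x :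
  @lusztig_T C n A M eps i (c *: x) = c *: lusztig_T eps i x.
Proof. by rewrite -[RHS]mul_malgC; exact: free_evalZ. Qed.

(** Lusztig's automorphism lifts a simple reflection on degrees; in particular
    [s_i alpha_j = alpha_j + s alpha_i] with [s = - a_ij] is the common degree of
    the terms with [s] factors [E_i] and one factor [E_j]. *)
Lemma homog_lusztig i b x :
  homog b x -> homog (simple_refl A i b) (lusztig_T eps i x).
Proof.
elim=> {b x} [j|j|mu|b||b x y _ hx _ hy|c b x _ hx|b1 b2 x y _ hx _ hy].
- rewrite /lusztig_T /Defs.freeE free_lift_gen /=; case: eqP => [->|/eqP ji].
    rewrite simple_refl_self -[- simple_root A i]addr0.
    by apply/homogN/homogM; [exact: homogF | exact: homogK].
  apply: homog_sum => r; apply: homogZ; rewrite simple_refl_root.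
  have -> : simple_root A j - A i j *: simple_root A i =
    simple_root A i *+ (`|A i j| - r) + simple_root A j + simple_root A i *+ r.
    have le0 : A i j <= 0 by apply: cartan_offdiag; rewrite eq_sym.
    rewrite addrAC -mulrnDr subnK; last by case: r.
    rewrite addrC; congr (_ + _); rewrite -scaleNr -scaler_nat natz.
    by rewrite abszE ler0_norm.
  by apply: homogM; [apply: homogM|]; [apply/homogZ/homogX/homogE |
    exact: homogE | apply/homogZ/homogX/homogE].
- rewrite /lusztig_T /freeF free_lift_gen /=; case: eqP => [->|/eqP ji].
    rewrite simple_reflN simple_refl_self opprK -[simple_root A i]add0r.
    by apply/homogN/homogM; [exact: homogK | exact: homogE].
  apply: homog_sum => r; apply: homogZ; rewrite simple_reflN simple_refl_root.
  have -> : - (simple_root A j - A i j *: simple_root A i) =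
    - simple_root A i *+ r - simple_root A j + - simple_root A i *+ (`|A i j| - r).
    have le0 : A i j <= 0 by apply: cartan_offdiag; rewrite eq_sym.
    rewrite addrAC -mulrnDr subnKC; last by case: r.
    rewrite opprB; congr (_ - _); rewrite mulNrn -scaler_nat natz.
    by rewrite abszE ler0_norm // scaleNr opprK.
  by apply: homogM; [apply: homogM|]; [apply/homogZ/homogX/homogF |
    exact: homogF | apply/homogZ/homogX/homogF].
- by rewrite /lusztig_T /freeK free_lift_gen simple_refl0; exact: homogK.
- by rewrite lusztig_T0; exact: homog0.
- by rewrite lusztig_T1 simple_refl0; exact: homog1.
- by rewrite lusztig_TD; exact: homogD.
- by rewrite lusztig_TZ; exact: homogZ.
- by rewrite lusztig_TM simple_reflD; exact: homogM.
Qed.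

Lemma size_lusztig_roots x w : size (@lusztig_roots C n A M eps x w) = size w.
Proof. by elim: w => //= i w IH; rewrite size_map IH. Qed.

Lemma homog_lusztig_roots_E w k : (k < size w)%N ->
  homog (nth 0 (word_roots A w) k) (nth 0 (lusztig_roots eps (@Defs.freeE C n A M) w) k).
Proof.
elim: w k => [|i w IH] [|k] //=; first by move=> _; exact: homogE.
rewrite ltnS => ltk.
rewrite (nth_map 0) ?size_word_roots // (nth_map 0) ?size_lusztig_roots //.
exact/homog_lusztig/IH.
Qed.

Lemma homog_lusztig_roots_F w k : (k < size w)%N ->
  homog (- nth 0 (word_roots A w) k) (nth 0 (lusztig_roots eps (@freeF C n A M) w) k).
Proof.
elim: w k => [|i w IH] [|k] //=; first by move=> _; exact: homogF.
rewrite ltnS => ltk.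
rewrite (nth_map 0) ?size_word_roots // (nth_map 0) ?size_lusztig_roots //.
rewrite -simple_reflN; exact/homog_lusztig/IH.
Qed.
End Grading.

(** * One-dimensional representations *)

Section OneDimensional.
Variables (C : fieldType) (n : nat) (A : simple_cartan n) (M : lattice A).
Variables (eps : C) (ell : nat) (w : seq 'I_n) (eta : SpecZ0 M eps ell w).

(** The target being commutative, the commutator relation reads
    [K_i - K_i^-1 = 0]. *)
Lemma character_of_representation (rho : representation (Ueta eta) 1) :
  (forall i, eps_root A eps i - (eps_root A eps i)^-1 != 0) ->
  exists2 chi, weight_character chi &
    (forall i, chi (root_weight M i) ^+ 2 = 1) /\
    (forall mu, chi mu ^+ ell = torus_part eta mu).
Proof.
move=> eps_neq0.
pose S := fun x : Ueps M eps => exists2 y : Z0 M eps ell w, eta y = 0 & x = val y.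
pose f (x : Ueps M eps) : C := rho (quot_proj S x) 0 0.
have fM x y : f (x * y) = f x * f y.
  by rewrite /f !rmorphM [LHS]mxE big_ord1.
have f1 : f 1 = 1 by rewrite /f !rmorph1 mxE.
have fB x y : f (x - y) = f x - f y by rewrite /f !rmorphB !mxE.
have f_scal c : f (scal c) = c.
  by rewrite /f (_ : quot_proj S _ = scal c) // alg_fun_scal !mxE eqxx.
have fX x k : f (x ^+ k) = f x ^+ k.
  by elim: k => [|k IH]; rewrite ?f1 // !exprS fM IH.
exists (fun mu => f (cartanK eps mu)).
  by split=> [|mu nu]; rewrite ?cartanK0 ?cartanKD ?f1 ?fM.
split=> [i|mu]; last first.
  rewrite -fX; set x := cartanK eps mu ^+ ell; apply/eqP.
  rewrite -subr_eq0 -[torus_part eta mu]f_scal -fB /f.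
  suff -> : quot_proj S (x - scal (torus_part eta mu)) = 0 by rewrite rmorph0 mxE.
  apply/eqP; rewrite -(rmorph0 (quot_proj S)); apply/quot_projP/ideal_gen.
  rewrite subr0; exists (Z0K eps ell w mu - scal (torus_part eta mu)) => //.
  by rewrite rmorphB alg_fun_scal /torus_part subrr.
pose g x := f (Uproj eps x).
have gM x y : g (x * y) = g x * g y by rewrite /g -fM /Uproj rmorphM.
have gB x y : g (x - y) = g x - g y by rewrite /g -fB /Uproj rmorphB.
have gZ c x : g (c *: x) = c * g x.
  by rewrite -mul_malgC gM; congr (_ * _); rewrite -[RHS]f_scal.
have g_rel x : quantum_relator eps x -> g x = 0.
  move=> rel_x; rewrite /g; suff -> : Uproj eps x = 0 by rewrite /f !rmorph0 mxE.
  apply/eqP; rewrite /Uproj -(rmorph0 (quot_proj (quantum_relator eps))).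
  by apply/quot_projP/ideal_gen; rewrite subr0.
have gK mu : g (freeK C mu) = f (cartanK eps mu) by [].
have g_rel_EF x y c u v :
    g (x * y - y * x - c *: (u - v)) = - (c * (g u - g v)).
  rewrite (gB (x * y - y * x)) gZ (gB u) (gB (x * y)).
  rewrite [X in X - _ - _]gM [X in _ - X - _]gM.
  by rewrite [X in X - _ - _]mulrC subrr sub0r.
clearbody g; have := g_rel _ (@rel_EF C n A M eps i i).
rewrite eqxx g_rel_EF !gK => /eqP.
rewrite oppr_eq0 mulf_eq0 invr_eq0 (negPf (eps_neq0 i)) /= subr_eq0 => /eqP fK.
by rewrite expr2 {2}fK -fM -cartanKD subrr cartanK0 f1.
Qed.

(** On [Z0] the map given by [chi] and sending all [E_i] and [F_i] to 0 agrees
    with [eta]: on powers of the [K_mu] by hypothesis, and on powers of root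
    vectors because both vanish there, a monomial of nonzero degree containing
    some [E_i] or [F_i]. *)
Lemma representation_of_character (chi : weight M -> C) :
  weight_character chi ->
  (forall i, chi (root_weight M i) ^+ 2 = 1) ->
  (forall mu, chi mu ^+ ell = torus_part eta mu) ->
  (0 < ell)%N ->
  (forall k : 'I_(size w), word_root A k != 0) ->
  (forall k, eta (Z0E M eps ell k) = 0) ->
  (forall k, eta (Z0F M eps ell k) = 0) ->
  inhabited (representation (Ueta eta) 1).
Proof.
move=> [chi0 chiD] chi_root chi_eta ell_gt0 w_neq0 etaE etaF.
pose h (g : generator M) : C := if g is inr mu then chi mu else 0.
pose phi : alg_hom (free_alg C M) C^o := free_char_hom h.
have phiE i : phi (Defs.freeE C M i) = 0 by exact: free_char_gen.
have phiF i : phi (freeF C M i) = 0 by exact: free_char_gen.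
have phiK mu : phi (freeK C mu) = chi mu by exact: free_char_gen.
have phiZ c x : phi (c *: x) = c * phi x :> C by exact: free_charZ.
have chiN i : chi (- root_weight M i) = chi (root_weight M i).
  have c0 : chi (root_weight M i) != 0.
    by apply/eqP => c0; have /eqP := chi_root i; rewrite c0 expr0n eq_sym oner_eq0.
  apply: (mulfI c0); rewrite -chiD subrr chi0.
  by rewrite -expr2 chi_root.
have phiM (x y : free_alg C M) : phi (x * y) = phi x * phi y := rmorphM phi x y.
have phiB (x y : free_alg C M) : phi (x - y) = phi x - phi y := rmorphB phi x y.
have phi_comm k x c : phi x = 0 -> phi (k * x - c *: (x * k)) = 0.
  move=> x0; rewrite (phiB (k * x)) phiZ [X in X - _]phiM [X in _ - _ * X]phiM.
  by rewrite x0 mul0r !mulr0 subrr.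
have phi_EF x y z : phi x = 0 -> phi y = 0 -> phi z = 0 ->
    phi (x * y - y * x - z) = 0.
  move=> x0 y0 z0; rewrite (phiB (x * y - y * x)) (phiB (x * y)).
  rewrite [X in X - _ - _]phiM [X in _ - X - _]phiM.
  by rewrite x0 y0 z0 mul0r !subr0.
have phi_serre x i j : phi (x j) = 0 -> phi (serre eps x i j) = 0.
  move=> x0; rewrite /serre rmorph_sum big1 // => a _.
  by rewrite phiZ !rmorphM x0 mulr0 mul0r mulr0.
have phi_rel x : quantum_relator eps x -> phi x = 0.
  case=> [|mu nu|mu i|mu i|i j|i j _|i j _].
  - by rewrite phiB [phi 1]rmorph1 phiK chi0 subrr.
  - by rewrite phiB phiM !phiK chiD subrr.
  - exact: phi_comm.
  - exact: phi_comm.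
  - apply: phi_EF => //; case: eqP => _; last exact: rmorph0.
    by rewrite phiZ [phi (_ - _)]rmorphB !phiK chiN subrr mulr0.
  - exact: phi_serre.
  - exact: phi_serre.
pose psi : alg_hom (Ueps M eps) C^o := quot_lift_hom phi_rel.
have psiE x : psi (Uproj eps x) = phi x by exact: quot_liftE.
have phi_homog b x : homog b x -> b != 0 -> phi x = 0.
  elim=> {b x} [i|i|mu|b||b x y _ hx _ hy|c b x _ hx|b1 b2 x y _ hx _ hy] //.
  - by rewrite eqxx.
  - by rewrite rmorph0.
  - by rewrite eqxx.
  - by move=> b0; rewrite rmorphD hx // hy // addr0.
  - by move=> b0; rewrite phiZ hx // mulr0.
  - rewrite rmorphM; have [->|/hx->] := eqVneq b1 0; last by rewrite mul0r.
    by rewrite add0r => /hy->; rewrite mulr0.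
have psi_eta x : generated_subalg (@lcenter_gen C n A M eps ell w) x ->
    forall y : Z0 M eps ell w, val y = x -> psi x = eta y.
  elim=> {x} [x Sx|c|x1 x2 g1 h1 g2 h2|x1 x2 g1 h1 g2 h2] y yx.
  - case: Sx yx => [k|k|mu] yx.
    + have -> : y = Z0E M eps ell k by apply: val_inj; exact: yx.
      rewrite etaE rmorphXn /Defs.rootE psiE.
      rewrite (phi_homog _ _ (homog_lusztig_roots_E _ _ (ltn_ord k)) (w_neq0 k)).
      by rewrite expr0n gtn_eqF.
    + have -> : y = Z0F M eps ell k by apply: val_inj; exact: yx.
      rewrite etaF rmorphXn /rootF psiE.
      rewrite (phi_homog _ _ (homog_lusztig_roots_F _ _ (ltn_ord k))).
        by rewrite expr0n gtn_eqF.
      by rewrite oppr_eq0; exact: w_neq0.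
    + have -> : y = Z0K eps ell w mu by apply: val_inj; exact: yx.
      by rewrite rmorphXn /cartanK psiE phiK [LHS]chi_eta.
  - have -> : y = scal c by apply: val_inj; exact: yx.
    by rewrite !alg_fun_scal.
  - have S1 : x1 \in subalg_pred (@lcenter_gen C n A M eps ell w) by exact/subalg_predP.
    have S2 : x2 \in subalg_pred (@lcenter_gen C n A M eps ell w) by exact/subalg_predP.
    have -> : y = (exist _ x1 S1 : Z0 M eps ell w) + (exist _ x2 S2 : Z0 M eps ell w).
      exact: val_inj.
    by rewrite !rmorphD -h1 // -h2.
  - have S1 : x1 \in subalg_pred (@lcenter_gen C n A M eps ell w) by exact/subalg_predP.
    have S2 : x2 \in subalg_pred (@lcenter_gen C n A M eps ell w) by exact/subalg_predP.
    have -> : y = (exist _ x1 S1 : Z0 M eps ell w) * (exist _ x2 S2 : Z0 M eps ell w).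
      exact: val_inj.
    by rewrite !rmorphM -h1 // -h2.
have psi_ker x : (exists2 y : Z0 M eps ell w, eta y = 0 & x = val y) -> psi x = 0.
  move=> [y y0 ->]; rewrite -y0; apply: psi_eta => //.
  exact/subalg_predP/(valP y).
pose rho : alg_hom (Ueta eta) C^o := quot_lift_hom psi_ker.
pose f : Ueta eta -> 'M[C]_1 := fun x => (rho x : C)%:M.
have f_zmod : zmod_morphism f by move=> x y; rewrite /f rmorphB raddfB.
have f_monoid : monoid_morphism f.
  by split=> [|x y]; rewrite /f ?rmorph1 // rmorphM scalar_mxM.
pose fR : {rmorphism Ueta eta -> 'M[C]_1} :=
  HB.pack f (GRing.isZmodMorphism.Build _ _ f f_zmod)
    (GRing.isMonoidMorphism.Build _ _ f f_monoid).
constructor; apply: (@AlgHom _ _ _ fR) => c.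
by rewrite /= /f alg_fun_scal.
Qed.
End OneDimensional.

(** * Roots of characters of the weight lattice *)

(** If [N] annihilates the quotient of [G] by the cyclic group of order [o]
    generated by [g], then by Cauchy's theorem every prime dividing the order
    [q] of that quotient divides [N]. *)
Lemma finite_zmod_index (G : finZmodType) (g : G) (N : nat) :
  (forall x : G, exists a : int, x *+ N = g *~ a) ->
  exists o q, [/\ #|G| = (o * q)%N, g *+ o = 0,
    forall b : int, g *~ b = 0 -> (o %| `|b|)%N &
    forall p, prime p -> (p %| q)%N -> (p %| N)%N].
Proof.
move=> hN; pose H := <[g]>%G; pose T := [set: G]%G.
have HT : H \subset T by apply: finset.subsetT.
have nHT : T \subset 'N(H)%g.
  by apply: sub_abelian_norm => //; apply: FinRing.zmod_abelian.
exists #|H|, #|T : H|%g; split.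
- by rewrite Lagrange //= finset.cardsT.
- by rewrite -FinRing.zmodXgE -FinRing.zmod1gE; exact: expg_order.
- move=> b gb; rewrite cyclic.order_dvdn FinRing.zmodXgE FinRing.zmod1gE.
  case: b gb => b; first by rewrite -pmulrn => ->.
  by rewrite NegzE mulrNz -pmulrn => /eqP; rewrite oppr_eq0.
move=> p p_pr; rewrite -card_quotient // => /(Cauchy p_pr)[y yT <-].
have /morphimP[x xN xT ->] := yT.
rewrite cyclic.order_dvdn -morphX //; apply/eqP/coset_id.
rewrite FinRing.zmodXgE; have [[a|a] ->] := hN x.
  by rewrite -pmulrn -FinRing.zmodXgE mem_cycle.
by rewrite NegzE mulrNz -pmulrn -FinRing.zmodXgE -FinRing.zmodVgE groupV mem_cycle.
Qed.

Lemma finite_zmod_order (G : finZmodType) (x : G) : x *+ #|G| = 0.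
Proof.
rewrite -FinRing.zmodXgE -FinRing.zmod1gE; apply/eqP; rewrite -cyclic.order_dvdn -finset.cardsT.
by apply: (@cyclic.order_dvdG _ [set: G]%G); rewrite inE.
Qed.

Section RootLatticeQuotient.
Variables (n : nat) (A : simple_cartan n) (M : lattice A).

Definition root_lattice_pred : {pred weight M} :=
  fun x => `[< in_root_lattice x >].

Lemma root_lattice_predP (x : weight M) :
  reflect (in_root_lattice x) (x \in root_lattice_pred).
Proof. exact: asboolP. Qed.

Fact root_lattice_zmod : zmod_closed root_lattice_pred.
Proof.
split=> [|x y /root_lattice_predP[c ->] /root_lattice_predP[d ->]];
  apply/root_lattice_predP.
  by exists (fun=> 0); rewrite big1 // => i _; rewrite mulr0z.
exists (fun i => c i - d i); rewrite -sumrB; apply: eq_bigr => i _.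
by rewrite mulrzBr.
Qed.

HB.instance Definition _ := GRing.isZmodClosed.Build (weight M) root_lattice_pred
  root_lattice_zmod.

Definition weight_quot : zmodType := Quotient.quot root_lattice_pred.
Definition weight_class (x : weight M) : weight_quot :=
  \pi_(Quotient.quot root_lattice_pred)%qT x.

Lemma weight_classP x y :
  reflect (in_root_lattice (x - y)) (weight_class x == weight_class y).
Proof. rewrite /weight_class -Quotient.idealrBE; exact: root_lattice_predP. Qed.

Fact weight_class_zmod : zmod_morphism weight_class.
Proof. by move=> x y; rewrite /weight_class !piE. Qed.

HB.instance Definition _ := GRing.isZmodMorphism.Build (weight M) weight_quot
  weight_class weight_class_zmod.

Lemma weight_class_surj q : exists x, q = weight_class x.
Proof.
exists (generic_quotient.repr (q : Quotient.quot root_lattice_pred)).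
by rewrite /weight_class reprK.
Qed.

Lemma root_weight_in_root_lattice i : in_root_lattice (root_weight M i).
Proof.
exists (fun j => (j == i)%:R); rewrite (bigD1 i) //= eqxx mulr1z big1 ?addr0 //.
by move=> j /negPf->; rewrite mulr0z.
Qed.

Variable m : nat.
Hypothesis Hm : card_eq (root_lattice_cosets M) `I_m.

Lemma weight_quot_bij : exists f : weight_quot -> 'I_m, bijective f.
Proof.
have /card_set_bijP[f [f_fun f_inj f_surj]] := Hm.
pose S (q : weight_quot) := [set nu : weight M | weight_class nu = q]%classic.
have SE x : S (weight_class x) = [set nu | in_root_lattice (nu - x)]%classic.
  apply/seteqP; split=> nu h; first exact/weight_classP/eqP.
  exact/eqP/weight_classP.
have S_in q : root_lattice_cosets M (S q).
  by have [x ->] := weight_class_surj q; exists x => //; rewrite SE.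
have f_lt q : (f (S q) < m)%N := f_fun _ (S_in q).
exists (fun q => Ordinal (f_lt q)).
have inj : injective (fun q => Ordinal (f_lt q)).
  move=> p q /(congr1 val) /= e; have : S p = S q.
    exact: (f_inj _ _ (mem_set (S_in p)) (mem_set (S_in q)) e).
  have [x ->] := weight_class_surj p => /seteqP[/(_ x) h _].
  exact: h.
have surj k : exists q, Ordinal (f_lt q) = k.
  have [B [x _ <-] fk] := f_surj _ (ltn_ord k).
  by exists (weight_class x); apply: val_inj; rewrite /= SE.
have /choice[g gK] := surj.
by exists g => // q; apply: inj; rewrite gK.
Qed.

Lemma weight_quot_finite : exists (G : finZmodType) (pi : {additive weight M -> G}),
  [/\ #|G| = m, forall q, exists x, q = pi x &
      forall x, in_root_lattice x <-> pi x = 0].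
Proof.
have [f [g fK gK]] := weight_quot_bij.
pose cT : countType := HB.pack weight_quot (CanIsCountable fK).
pose finM := @CanIsFinite cT _ f g fK.
pose G : finZmodType := HB.pack weight_quot (CanIsCountable fK) finM.
exists G, (weight_class : {additive weight M -> weight_quot}); split.
- rewrite -[RHS]card_ord; apply: (bij_eq_card (f := (f : G -> 'I_m))).
  by exists g.
- exact: weight_class_surj.
- move=> x; rewrite -[X in in_root_lattice X]subr0 -(raddf0 weight_class).
  by split=> [/weight_classP/eqP | /eqP/weight_classP].
Qed.

Lemma root_lattice_exponent (x : weight M) : in_root_lattice (x *+ m).
Proof.
have [G [pi [cardG _ piP]]] := weight_quot_finite.
by apply/piP; rewrite raddfMn -cardG finite_zmod_order.
Qed.

Lemma weight_quot_gt0 : (0 < m)%N.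
Proof.
have [G [pi [<- _ _]]] := weight_quot_finite.
by apply/card_gt0P; exists 0.
Qed.

Lemma root_lattice_index (gamma : weight M) (N : nat) :
  (forall x : weight M, exists a : int, in_root_lattice (x *+ N - gamma *~ a)) ->
  exists o q, [/\ m = (o * q)%N, in_root_lattice (gamma *+ o),
    forall b : int, in_root_lattice (gamma *~ b) -> (o %| `|b|)%N &
    forall p, prime p -> (p %| q)%N -> (p %| N)%N].
Proof.
have [G [pi [cardG pi_surj piP]]] := weight_quot_finite => hN.
have hpi (y : G) : exists a : int, y *+ N = pi gamma *~ a.
  have [x ->] := pi_surj y; have [a /piP] := hN x.
  by rewrite raddfB raddfMn raddfMz => /eqP; rewrite subr_eq0 => /eqP; exists a.
have [o [q [e go oP pq]]] := finite_zmod_index hpi.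
exists o, q; rewrite -cardG; split=> //.
- by apply/piP; rewrite raddfMn go.
- by move=> b /piP; rewrite raddfMz; exact: oP.
Qed.
End RootLatticeQuotient.

Lemma sub_rearrange (V : zmodType) (X Y a b c : V) :
  a + b - c = (X + Y - c) - (X - a) - (Y - b).
Proof.
rewrite !opprB [X + Y - c + _]addrC -[X + Y - c]addrA addrA subrK.
by rewrite [RHS]addrC [a + (Y - c)]addrCA addrA subrK addrA [b + a]addrC.
Qed.

Section CharacterRoot.
Variables (n : nat) (A : simple_cartan n) (M : lattice A).
Variable C : numClosedFieldType.

Lemma expr_coprime_eq1 (x : C) a b : (0 < a)%N -> coprime a b ->
  x ^+ a = 1 -> x ^+ b = 1 -> x = 1.
Proof.
move=> a0 /eqP cop xa xb; case: (egcdnP b a0) => km kn; rewrite cop => e _.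
have <- : x ^+ (km * a) = x.
  by rewrite e exprD [(kn * b)%N]mulnC exprM xb expr1n mul1r.
by rewrite mulnC exprM xa expr1n.
Qed.

(** The integers [a] with [a omega] in [M] form an ideal of [Z], which is
    principal, possibly zero. *)
Lemma lattice_line_generator (omega : 'rV[int]_n) : exists g : int,
  g *: omega \in lattice_pred M /\
  forall a : int, a *: omega \in lattice_pred M -> exists k, a = k * g.
Proof.
pose I (a : nat) := (0 < a)%N && (a%:Z *: omega \in lattice_pred M).
have absI (a : int) : a *: omega \in lattice_pred M -> `|a|%N%:Z *: omega \in lattice_pred M.
  by case: a => a //; rewrite NegzE scaleNr rpredN.
have [exI|noI] := pselect (exists a, I a); last first.
  exists 0; rewrite scale0r rpred0; split=> // a Ma; exists 0.
  rewrite mul0r; apply/eqP; apply: contra_notT noI => a0; exists `|a|%N.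
  by rewrite /I absz_gt0 a0 absI.
case: (ex_minnP exI) => g /andP[g0 Mg] g_min.
exists g; split=> // a Ma; exists (a %/ g)%Z.
have Mr : (a %% g)%Z *: omega \in lattice_pred M.
  rewrite (_ : (a %% g)%Z = a - (a %/ g)%Z * g%:Z); last first.
    by rewrite {2}(divz_eq a g) addrC addKr.
  rewrite scalerBl rpredB // -scalerA -[X in X *: _]intz scaler_int rpredMz //.
apply/eqP; rewrite -subr_eq0 {1}(divz_eq a g) addrAC subrr add0r.
apply: contraT => r0; have := g_min `|(a %% g)%Z|%N.
rewrite /I absz_gt0 r0 absI // => /(_ isT).
have := ltz_pmod a (d := g%:Z) g0; have := @modz_ge0 a g%:Z.
rewrite gt_eqF // => /(_ isT); move: (a %% g)%Z => r; clear; lia.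
Qed.

(** Let [gamma] generate the intersection of [M] with [Z omega], of order [o]
    modulo [Q]. The index of [Z gamma + Q] in [M] is prime to [ell], so the
    hypothesis on [chi] becomes [chi gamma ^ (o / d) = 1]. Then [chi gamma] has
    an [ell]-th root [zeta] with [zeta ^ o = 1]. With [omega] and [N] as in
    [weights_mod_roots_cyclic], [zeta] defines a character whose [ell]-th power
    is [chi ^ N]; since [N] is prime to [ell], [chi] itself is an [ell]-th
    power. *)
Lemma character_root (m ell : nat) (chi : weight M -> C) :
  card_eq (root_lattice_cosets M) `I_m ->
  (1 < ell)%N -> odd ell -> (is_G2 A -> coprime ell 3) ->
  weight_character chi -> (forall i, chi (root_weight M i) = 1) ->
  (forall x, chi x ^+ (m %/ gcdn ell m) = 1) ->
  exists y, [/\ weight_character y, forall i, y (root_weight M i) = 1 &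
    forall x, y x ^+ ell = chi x].
Proof.
move=> Hm ell_gt1 ell_odd ellG2 chiM chi_root chi_m.
have [chi0 chiD] := chiM; have ell_gt0 := ltnW ell_gt1.
have [omega [N [copN omegaN]]] := weights_mod_roots_cyclic ell_odd ellG2.
have N_gt0 : (0 < N)%N.
  by case: N copN {omegaN} => //; rewrite /coprime gcdn0 => /eqP e; rewrite e in ell_gt1.
have [g [Mg g_gen]] := lattice_line_generator omega.
pose gamma : weight M := exist _ (g *: omega) Mg.
have gammaN (x : weight M) : exists a : int, in_root_lattice (x *+ N - gamma *~ a).
  have [a [c e]] := omegaN (val x).
  have val_c : val (\sum_i root_weight M i *~ c i) = \sum_i c i *: simple_root A i.
    by rewrite raddf_sum; apply: eq_bigr => i _; rewrite /= val_weightMz.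
  have Ma : a *: omega \in lattice_pred M.
    have -> : a *: omega = val (x *+ N - \sum_i root_weight M i *~ c i).
      by rewrite val_weightB val_weightMn e val_c addrK.
    exact: valP.
  have [k ak] := g_gen a Ma; exists k, c; apply: val_inj.
  by rewrite val_c val_weightB val_weightMn e val_weightMz /= scalerA -ak addrC addKr.
have [o [q [m_oq gamma_o o_dvd q_dvd]]] := root_lattice_index Hm gammaN.
have m_gt0 := weight_quot_gt0 Hm.
have o_gt0 : (0 < o)%N by move: m_gt0; rewrite m_oq muln_gt0 => /andP[].
have q_gt0 : (0 < q)%N by move: m_gt0; rewrite m_oq muln_gt0 => /andP[].
have cop_q : coprime ell q.
  rewrite coprime_has_primes //; apply/hasPn => p.
  rewrite !mem_primes ell_gt0 q_gt0 => /and3P[p_pr _ pq]; rewrite p_pr /=.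
  apply/negP => pl; have pN := q_dvd p p_pr pq.
  have : (p %| gcdn ell N)%N by rewrite dvdn_gcd pl.
  by rewrite (eqP copN) Euclid_dvd1.
(* As [q] is prime to [ell], [o] may replace [m] in the greatest common divisor. *)
pose d := gcdn ell o; have d_gt0 : (0 < d)%N by rewrite gcdn_gt0 ell_gt0.
have dm : gcdn ell m = d by rewrite m_oq Gauss_gcdl.
have [s os] : exists s, o = (s * d)%N by apply/dvdnP/dvdn_gcdr.
have m_d : (m %/ gcdn ell m = s * q)%N.
  by rewrite dm m_oq os mulnAC mulnK.
pose z0 := chi gamma.
have z0s : z0 ^+ s = 1.
  apply: (@expr_coprime_eq1 _ q d) => //.
  - by apply: coprime_dvdr (dvdn_gcdl _ _) _; rewrite coprime_sym.
  - by rewrite -exprM -m_d; exact: chi_m.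
  - by rewrite -exprM -os -charMn // (char_root_lattice chiM chi_root).
pose xi := d.-root z0.
have xi_d : xi ^+ d = z0 by rewrite /xi rootCK.
have xi_o : xi ^+ o = 1 by rewrite os mulnC exprM xi_d.
(* With [u ell = v o + d], the power [xi ^ u] has [ell]-th power [xi ^ d]. *)
have [zeta zeta_ell zeta_o] : exists2 zeta : C, zeta ^+ ell = z0 & zeta ^+ o = 1.
  case: (egcdnP o ell_gt0) => u v uv _; exists (xi ^+ u); last first.
    by rewrite -exprM mulnC exprM xi_o expr1n.
  by rewrite -exprM uv exprD [(v * o)%N]mulnC exprM xi_o expr1n mul1r.
have zeta_neq0 : zeta != 0.
  by apply: contraTneq isT => z; have := zeta_o; rewrite z expr0n gtn_eqF // => /eqP; rewrite eq_sym oner_eq0.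
(* Hence [zeta ^ a x] does not depend on the choice of [a x] below. *)
have zeta_dvd (b : int) : in_root_lattice (gamma *~ b) -> zeta ^ b = 1.
  move/o_dvd => /dvdnP[k ek]; have zk : zeta ^+ `|b|%N = 1.
    by rewrite ek mulnC exprM zeta_o expr1n.
  case: (b) zk => b' zk; first exact: zk.
  by rewrite -[LHS]/((zeta ^+ b'.+1)^-1) [_ ^+ _]zk invr1.
have /choice[a ha] := gammaN.
have aD x y : zeta ^ a (x + y) = zeta ^ a x * zeta ^ a y.
  have z1 : zeta ^ (a x + a y - a (x + y)) = 1.
    apply/zeta_dvd/root_lattice_predP.
    have -> : gamma *~ (a x + a y - a (x + y)) = ((x + y) *+ N - gamma *~ a (x + y))
        - (x *+ N - gamma *~ a x) - (y *+ N - gamma *~ a y).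
      by rewrite mulrzBr mulrzDr mulrnDl; exact: sub_rearrange.
    by apply: rpredB; [apply: rpredB|]; apply/root_lattice_predP.
  rewrite -expfzDr // -[LHS]mulr1 -z1 -expfzDr //.
  by rewrite [_ + (_ - a (x + y))]addrC subrK.
have zeta_mult : weight_character (fun x => zeta ^ a x).
  split=> //; have e := aD 0 0; rewrite addr0 in e.
  by apply: (@mulfI _ (zeta ^ a 0)); rewrite ?mulr1 -?e // expfz_neq0.
have zeta_chi x : (zeta ^ a x) ^+ ell = chi x ^+ N.
  have -> : (zeta ^ a x) ^+ ell = z0 ^ a x.
    by rewrite -zeta_ell -[_ ^+ ell]/(_ ^ ell%:Z) exprzAC.
  have /(char_root_lattice chiM chi_root) := ha x.
  rewrite chiD (charN chiM) (charMn chiM) (charMz chiM) -/z0 => e.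
  by apply/esym/(divr1_eq e).
(* From [u N = v ell + 1]: the power [u] of the character has [ell]-th power
   [chi ^ (v ell + 1)], and the factor [chi ^ (v ell)] is divided out. *)
case: (egcdnP ell N_gt0) => u v; rewrite gcdnC (eqP copN) => uv _.
exists (fun x => (zeta ^ a x) ^+ u / chi x ^+ v); split=> [|i|x].
- split=> [|x y]; first by rewrite zeta_mult.1 chi0 !expr1n divr1.
  by rewrite zeta_mult.2 chiD !exprMn invfM mulrACA.
- rewrite chi_root expr1n divr1 zeta_dvd ?expr1n //; apply/root_lattice_predP.
  have -> : gamma *~ a (root_weight M i) = root_weight M i *+ N
     - (root_weight M i *+ N - gamma *~ a (root_weight M i)) by rewrite subKr.
  apply: rpredB; last exact/root_lattice_predP.
  by apply: rpredMn; apply/root_lattice_predP; exact: root_weight_in_root_lattice.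
- rewrite exprMn exprVn -!exprM [(u * ell)%N]mulnC exprM zeta_chi -exprM mulnC uv.
  by rewrite exprD expr1 mulrAC divff ?mul1r // expf_neq0 // (char_neq0 chiM).
Qed.
End CharacterRoot.

(** * Order of a torus element *)

Section MatrixOrder.
Variables (C : fieldType) (N : nat).

(** The convention that an infinite order is 0 is consistent with divisibility,
    as 0 divides no positive [k]. *)
Lemma dvdn_mx_order (z : 'M[C]_N) k : (0 < k)%N ->
  (mx_order z %| k)%N <-> z ^+ k = 1.
Proof.
move=> k_gt0; rewrite /mx_order; case: pselect => [z_fin|no].
  case: ex_minnP => o /andP[o_gt0 /eqP zo] o_min.
  have zmod : z ^+ k = z ^+ (k %% o).
    by rewrite {1}(divn_eq k o) exprD mulnC exprM zo expr1n mul1r.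
  rewrite zmod /dvdn; split=> [/eqP-> //|z1].
  apply: contraT; rewrite -lt0n => r_gt0.
  by have := o_min (k %% o)%N; rewrite r_gt0 z1 eqxx leqNgt ltn_pmod // => /(_ isT).
rewrite dvd0n; split=> [/eqP k0|zk]; first by rewrite k0 in k_gt0.
by case: no; exists k; rewrite k_gt0 zk eqxx.
Qed.
End MatrixOrder.

Section Torus.
Variables (C : fieldType) (n : nat) (A : simple_cartan n) (M : lattice A).
Variables (N : nat) (V : chevalley_rep C M N).

Lemma torus_mxX (t : weight M -> C) k :
  torus_mx V t ^+ k = torus_mx V (fun mu => t mu ^+ k).
Proof.
elim: k => [|k IH].
  by rewrite expr0; apply/matrixP => i j; rewrite !mxE expr0.
rewrite exprS IH -[_ * _]/(torus_mx V t *m _); apply/matrixP => i j.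
by rewrite /torus_mx mul_diag_mx !mxE mulrnAr exprS.
Qed.

Lemma torus_mx_eq1 (t : weight M -> C) :
  torus_mx V t = 1 <-> forall k, t (rep_weight V k) = 1.
Proof.
split=> [/matrixP h k|h]; first by have := h k k; rewrite !mxE eqxx.
by apply/matrixP => i j; rewrite !mxE h.
Qed.
End Torus.

Local Open Scope complex_scope.

Theorem proposition6p1
  (R : realType)
  (n : nat) (A : simple_cartan n) (M : lattice A)
  (m : nat) (Hm : card_eq (root_lattice_cosets M) `I_m)
  (ell : nat) (Hell : (1 < ell)%N) (Hodd : odd ell)
  (HG2 : is_G2 A -> coprime ell 3)
  (eps : R[i]) (Heps : ell.-primitive_root eps)
  (w : seq 'I_n) (Hw : reduced_word_w0 A w)
  (N : nat) (V : chevalley_rep R[i] M N)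
  (X : 'rV[int]_n -> 'M[R[i]]_N) (HX : root_vectors V X)
  (eta : SpecZ0 M eps ell w)
  (z : 'M[R[i]]_N) (Hz : chevalley_center V z) (Hpi : pi_M V X eta = z) :
  inhabited (representation (Ueta eta) 1) <->
  (mx_order z %| m %/ gcdn ell m)%N.
Proof.
have ell_gt0 := ltnW Hell; have [w_red _] := Hw.
have m_gt0 := weight_quot_gt0 Hm.
rewrite -Hpi in Hz.
have [zE etaE etaF t_root] := pi_central w_red HX Hz; rewrite -Hpi {Hpi} zE.
set t := torus_part eta in t_root *.
have tM : weight_character t := torus_part_character eta.
have d_dvd : (gcdn ell m %| m)%N := dvdn_gcdr _ _.
have k_gt0 : (0 < m %/ gcdn ell m)%N by rewrite divn_gt0 ?gcdn_gt0 ?ell_gt0 // dvdn_leq.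
rewrite dvdn_mx_order // -exprM torus_mxX torus_mx_eq1.
split=> [[rho] k|tk].
  have eps_neq0 i : eps_root A eps i - (eps_root A eps i)^-1 != 0.
    have cop := coprime_half_norm i Hodd HG2.
    apply/eqP => /eqP; rewrite subr_eq0 => /eqP e.
    (* [eps_i = eps_i^-1] would make [ell] divide [2 d_i], hence 2. *)
    have eps0 : eps != 0.
      apply: contraTneq isT => e0; have := prim_expr_order Heps.
      by rewrite e0 expr0n gtn_eqF // => /eqP; rewrite eq_sym oner_eq0.
    have e0 : eps_root A eps i != 0 by rewrite expf_neq0.
    have : eps ^+ (half_norm A i * 2) = 1.
      by rewrite exprM expr2 {2}[_ ^+ _]e divff.
    move/eqP; rewrite -(prim_order_dvd Heps) Gauss_dvdr // => /(dvdn_leq (isT : 0 < 2)%N) le2.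
    have ell2 : ell = 2%N by apply/eqP; rewrite eqn_leq le2.
    by move: Hodd; rewrite ell2.
  have [chi chiM [chi_root chi_ell]] := character_of_representation rho eps_neq0.
  set mu := rep_weight V k.
  have exponent : (ell * (2 * (m %/ gcdn ell m)) = 2 * m * (ell %/ gcdn ell m))%N.
    by rewrite mulnCA muln_divCA_gcd mulnA.
  rewrite /t -chi_ell -exprM exponent 2!exprM -(charMn (weight_characterX 2 chiM)).
  rewrite (char_root_lattice (weight_characterX 2 chiM) chi_root) ?expr1n //.
  exact: root_lattice_exponent.
have t2M : weight_character (fun mu => t mu ^+ 2) := weight_characterX 2 tM.
have t_exp mu : (t mu ^+ 2) ^+ (m %/ gcdn ell m) = 1.
  have [c ->] := rep_weight_span V mu; have kM := weight_characterX (m %/ gcdn ell m) t2M.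
  elim/big_rec: _ => [|k x _ hx]; first exact: kM.1.
  by rewrite (kM.2 _ x) hx mulr1 (charMz kM) -exprM tk exp1rz.
have [y [yM y_root y_ell]] := character_root Hm Hell Hodd HG2 t2M t_root t_exp.
have y0 := char_neq0 yM.
(* With [ell = 2 k + 1] and [y ^ ell = t^2], the character [t y^-k] has square [y]
   and [ell]-th power [t]. *)
pose chi mu := t mu / y mu ^+ ell./2.
apply: (@representation_of_character _ _ _ _ _ _ _ _ chi) => //.
- split=> [|mu nu]; first by rewrite /chi tM.1 yM.1 expr1n divr1.
  by rewrite /chi tM.2 yM.2 exprMn invfM mulrACA.
- by move=> i; rewrite /chi y_root expr1n divr1 t_root.
- move=> mu; rewrite /chi exprMn exprVn exprAC y_ell.
  rewrite -{1}(odd_double_half ell) Hodd add1n exprS -mul2n exprM.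
  by rewrite -mulrA divff ?mulr1 // !expf_neq0 // (char_neq0 tM).
- move=> k; have [c [e _ [i ci]]] := word_root_positive w_red (ltn_ord k).
  apply: contraNneq ci => k0.
  have c0 : root_comb A c = 0 by rewrite -[LHS]e; exact: k0.
  by rewrite (root_comb_eq0 c0).
Qed.
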